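(* Consider the matrix differential equation $\frac{d}{dt}X(t)=F(X(t),t)$, $X(t)\in\mathbb{R}^{m_1\times m_2}$, $X(0)=X_0$, $t\in[0,T]$, with $$F(X,t)=\sum_{j=1}^{s}A_jXB_j^\top+G(t),$$ where $A_j\in\mathbb{R}^{m_1\times m_1}$, $B_j\in\mathbb{R}^{m_2\times m_2}$ and $G(t)\in\mathbb{R}^{m_1\times m_2}$ is a given function with a known low-rank decomposition. Assume that $F$ is sufficiently smooth (so that the discussion of higher-order methods is appropriate) and that $F$ is Lipschitz continuous in both variables and bounded, i.e. there exist constants $L,B>0$ such that $$\|F(Y,s)-F(Z,t)\|\le L\|Y-Z\|+L|s-t|,\qquad \|F(X,t)\|\le B .$$ Let $X_{n+1}$ be the result of one step of the SDC-mBUG scheme (described in the context) from $t_n$ to $t_{n+1}$, with $K$ corrections, $P$ substeps and truncation tolerances $\varepsilon_s,\varepsilon_f,\varepsilon_s^{(k+1)},\varepsilon_f^{(k)},\varepsilon_r^{(k)}$ ($k=1,\dots,K$), started from the exact value $X_n=X(t_n)$. Suppose that the time step $h=t_{n+1}-t_n$ is small enough (i.e. $hL\le\gamma<1$ for some $\gamma>0$). Then the local truncation error satisfies $$\|X_{n+1}-X(t_{n+1})\|\le C_{K+1}\left(\delta^{(K+1)}+h^{\min(K+2,\,P+2)}\right),$$ where $C_{K+1}$ is a constant that depends on $L,B,P,K,\gamma$, and $\delta^{(k+1)}$ satisfies $$\delta^{(1)}=\mathcal{O}(\varepsilon_s+\varepsilon_f h),$$ $$\delta^{(k+1)}=\mathcal{O}\left(h\,\delta^{(k)}+\left(\varepsilon_s^{(k+1)}+h\,\varepsilon_f^{(k)}+\varepsilon_r^{(k)}\right)\right)=\mathcal{O}\left(h^{k}\varepsilon_s+h^{k+1}\varepsilon_f+\sum_{i=1}^{k}h^{k-i}\left(\varepsilon_s^{(i+1)}+h\,\varepsilon_f^{(i)}+\varepsilon_r^{(i)}\right)\right),\quad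 k=1,\dots,K.$$
   Context: **Norm.** $\|\cdot\|$ is the Frobenius norm on matrices. **Truncation.** $\mathcal{T}_\varepsilon$ denotes a low-rank truncation operator on matrices, satisfying $\operatorname{rank}(\mathcal{T}_\varepsilon(X))\le\operatorname{rank}(X)$ and $\|X-\mathcal{T}_\varepsilon(X)\|\le\varepsilon$; its output is given as an SVD. The two operators used are the following: with $X=U\operatorname{diag}(\sigma_1,\dots,\sigma_r)V^\top$ a reduced SVD, hard truncation replaces every $\sigma_j\le\alpha$ by $0$ and keeps the others; soft truncation replaces every $\sigma_j$ by $\max(\sigma_j-\alpha,0)$; in each case $\alpha>0$ is chosen as large as possible subject to the truncation error being at most $\varepsilon$. For a sum of low-rank matrices given by SVDs $U_jS_jV_j^\top$, $\mathcal{T}^{\mathrm{sum}}_\varepsilon(\sum_jU_jS_jV_j^\top)$ denotes the truncated SVD of the sum, computed by QR factorization of the concatenated factors $[U_1,U_2,\dots]$ and $[V_1,V_2,\dots]$ followed by $\mathcal{T}_\varepsilon$ applied to the resulting small core matrix. For $X=USV^\top$, $\mathcal{T}^{\mathrm{sum}}_\varepsilon\circ F(X,t)$ denotes $\mathcal{T}^{\mathrm{sum}}_\varepsilon\big(\sum_{j=1}^sA_jUS(B_jV)^\top+G(t)\big)$. **Orthogonalization.** For a matrix $A$, $[\widehat U,\sim,\sim]=\operatorname{qr}(A)$ means that $\widehat U$ is the orthonormal factor of the column-pivoted QR factorization of $A$, so its columns form an orthonormal basis of the column space of $A$. **Nodes and quadrature.** The interval $[t_n,t_{n+1}]$ is divided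 into $P$ subintervals by points $t_n=t_{n,0}<t_{n,1}<\dots<t_{n,P}=t_{n+1}$ (which can be chosen to be the Legendre Gauss–Lobatto nodes), and $\Delta t_{n,m}=t_{n,m+1}-t_{n,m}$. The weights are $$w_{m,s}=\frac{1}{\Delta t_{n,m}}\int_{t_{n,m}}^{t_{n,m+1}}\prod_{j=0,\,j\ne s}^{P}\frac{t-t_{n,j}}{t_{n,s}-t_{n,j}}\,dt,$$ so that $\Delta t_{n,m}\sum_{s=0}^P w_{m,s}f(t_{n,s})$ is the integral over $[t_{n,m},t_{n,m+1}]$ of the $P$-th degree polynomial interpolating $f$ at $t_{n,0},\dots,t_{n,P}$. **SDC-mBUG scheme from $t_n$ to $t_{n+1}$.** Parameters: $K$ (number of corrections), $P$ (number of substeps), and tolerances $\varepsilon_s,\varepsilon_f$ and $\varepsilon_s^{(k+1)},\varepsilon_f^{(k)},\varepsilon_r^{(k)}$ for $k=1,\dots,K$. Input $X_n$. Every iterate is stored as an SVD $X^{(k)}_{n,m}=U^{(k)}_{n,m}S^{(k)}_{n,m}(V^{(k)}_{n,m})^\top$ and approximates $X(t_{n,m})$. *Stage 1 (initial approximation).* Set $X^{(1)}_{n,0}=X_n$. For $m=0,\dots,P-1$: 1. Compute $U^{(1)}_{F,n,m}S^{(1)}_{F,n,m}(V^{(1)}_{F,n,m})^\top=\mathcal{T}^{\mathrm{sum}}_{\varepsilon_f}\circ F(X^{(1)}_{n,m},t_{n,m})$. 2. Solve for $K^{(1)}_{n,m+1}$ and $L^{(1)}_{n,m+1}$: $$K^{(1)}_{n,m+1}=X^{(1)}_{n,m}V^{(1)}_{n,m}+\Delta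 t_{n,m}F\big(K^{(1)}_{n,m+1}(V^{(1)}_{n,m})^\top,t_{n,m+1}\big)V^{(1)}_{n,m},$$ $$L^{(1)}_{n,m+1}=(X^{(1)}_{n,m})^\top U^{(1)}_{n,m}+\Delta t_{n,m}F\big(U^{(1)}_{n,m}(L^{(1)}_{n,m+1})^\top,t_{n,m+1}\big)^\top U^{(1)}_{n,m}.$$ 3. Set $[\widehat U,\sim,\sim]=\operatorname{qr}([U^{(1)}_{n,m},U^{(1)}_{F,n,m},K^{(1)}_{n,m+1}])$ and $[\widehat V,\sim,\sim]=\operatorname{qr}([V^{(1)}_{n,m},V^{(1)}_{F,n,m},L^{(1)}_{n,m+1}])$. 4. Solve for $\widehat S^{(1)}_{n,m+1}$: $\widehat S^{(1)}_{n,m+1}=\widehat U^\top X^{(1)}_{n,m}\widehat V+\Delta t_{n,m}\widehat U^\top F(\widehat U\widehat S^{(1)}_{n,m+1}\widehat V^\top,t_{n,m+1})\widehat V$. 5. Compute $\mathcal{T}_{\varepsilon_s}(\widehat S^{(1)}_{n,m+1})=P'S^{(1)}_{n,m+1}Q^\top$ (SVD) and set $U^{(1)}_{n,m+1}=\widehat UP'$, $V^{(1)}_{n,m+1}=\widehat VQ$. *Stage 2 (successive corrections).* For $k=1,\dots,K$, set $X^{(k+1)}_{n,0}=X_n$ and: 1. For $m=0,\dots,P$ compute $U^{(k)}_{F,n,m}S^{(k)}_{F,n,m}(V^{(k)}_{F,n,m})^\top=\mathcal{T}^{\mathrm{sum}}_{\varepsilon_f^{(k)}}\circ F(X^{(k)}_{n,m},t_{n,m})$.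 2. For $m=0,\dots,P-1$ compute $$U^{(k)}_{R,n,m}S^{(k)}_{R,n,m}(V^{(k)}_{R,n,m})^\top=\mathcal{T}^{\mathrm{sum}}_{\varepsilon_r^{(k)}}\Big(-\Delta t_{n,m}U^{(k)}_{F,n,m+1}S^{(k)}_{F,n,m+1}(V^{(k)}_{F,n,m+1})^\top+\Delta t_{n,m}\sum_{s=0}^P w_{m,s}U^{(k)}_{F,n,s}S^{(k)}_{F,n,s}(V^{(k)}_{F,n,s})^\top\Big).$$ 3. For $m=0,\dots,P-1$ successively: set $[\widehat U,\sim,\sim]=\operatorname{qr}([U^{(k+1)}_{n,m},U^{(k)}_{F,n,m+1},U^{(k)}_{R,n,m}])$ and $[\widehat V,\sim,\sim]=\operatorname{qr}([V^{(k+1)}_{n,m},V^{(k)}_{F,n,m+1},V^{(k)}_{R,n,m}])$; solve for $\widehat S^{(k+1)}_{n,m+1}$: $$\widehat S^{(k+1)}_{n,m+1}=\widehat U^\top X^{(k+1)}_{n,m}\widehat V+\Delta t_{n,m}\widehat U^\top F(\widehat U\widehat S^{(k+1)}_{n,m+1}\widehat V^\top,t_{n,m+1})\widehat V+\widehat U^\top U^{(k)}_{R,n,m}S^{(k)}_{R,n,m}(V^{(k)}_{R,n,m})^\top\widehat V;$$ compute $\mathcal{T}_{\varepsilon_s^{(k+1)}}(\widehat S^{(k+1)}_{n,m+1})=P'S^{(k+1)}_{n,m+1}Q^\top$ (SVD) and set $U^{(k+1)}_{n,m+1}=\widehat UP'$, $V^{(k+1)}_{n,m+1}=\widehat VQ$.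 Output: $X_{n+1}=X^{(K+1)}_{n,P}$.
   Formalization: The constant C_{K+1} may also depend on the relative positions of the nodes and on a bound M for the time derivatives of F up to order P+1 (the meaning given to ''sufficiently smooth''), as dependence on L,B,P,K,γ alone is false; boundedness of F by B is asked only on a set containing the solution. *)

(* Defs.v *)
From HB Require Import structures.
From mathcomp Require Import all_boot all_order all_algebra all_fingroup.
From mathcomp Require Import all_classical all_reals all_analysis.

Set Implicit Arguments.
Unset Strict Implicit.
Unset Printing Implicit Defensive.

Import Order.TTheory GRing.Theory Num.Theory.
Import numFieldNormedType.Exports.

Local Open Scope classical_set_scope.
Local Open Scope ring_scope.

(* The library's norm on matrices is the sup norm of the entries; it is used
   below only through the (norm-independent) topology, never in an estimate. *)
Definition frob (R : realType) (m n : nat) (A : 'M[R]_(m, n)) : R :=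
  Num.sqrt (\sum_i \sum_j A i j ^+ 2).

(* A matrix stored through factors, U *m S *m V^T, with its own inner
   dimension.  The factors need not be orthonormal nor S diagonal: see [svd]. *)
Record lrmx (R : realType) (m n : nat) := LR {
  lrk : nat;
  lrU : 'M[R]_(m, lrk);
  lrS : 'M[R]_lrk;
  lrV : 'M[R]_(n, lrk) }.
Arguments LR {R m n lrk}.

Definition lrmat (R : realType) (m n : nat) (X : lrmx R m n) : 'M[R]_(m, n) :=
  lrU X *m lrS X *m (lrV X)^T.

Definition svd (R : realType) (m n : nat) (X : lrmx R m n) : Prop :=
  [/\ (lrU X)^T *m lrU X = 1%:M, (lrV X)^T *m lrV X = 1%:M,
      is_diag_mx (lrS X) & forall i, 0 <= lrS X i i].

Definition lr0 (R : realType) (m n : nat) : lrmx R m n :=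
  @LR R m n 0 0 0 0.

(* Formal sum: the outer factors are concatenated, [U1, U2] and [V1, V2]. *)
Definition lradd (R : realType) (m n : nat) (X Y : lrmx R m n) : lrmx R m n :=
  LR (row_mx (lrU X) (lrU Y)) (block_mx (lrS X) 0 0 (lrS Y))
     (row_mx (lrV X) (lrV Y)).

Definition lrscale (R : realType) (m n : nat) (a : R) (X : lrmx R m n) :
  lrmx R m n := LR (lrU X) (a *: lrS X) (lrV X).

Lemma lrmat0 (R : realType) (m n : nat) : lrmat (lr0 R m n) = 0.
Proof. by rewrite /lrmat /lr0 /= mul0mx mul0mx. Qed.

Lemma lrmatD (R : realType) (m n : nat) (X Y : lrmx R m n) :
  lrmat (lradd X Y) = lrmat X + lrmat Y.
Proof.
rewrite /lrmat /lradd /= mul_row_block !mulmx0 addr0 add0r.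
by rewrite tr_row_mx mul_row_col.
Qed.

Lemma lrmatZ (R : realType) (m n : nat) (a : R) (X : lrmx R m n) :
  lrmat (lrscale a X) = a *: lrmat X.
Proof. by rewrite /lrmat /lrscale /= -scalemxAr -scalemxAl. Qed.

(* Thin, rank-revealing QR factorization with column pivoting:
   col_perm s A = Q *m (col_perm s W), where Q has orthonormal columns and
   col_perm s W is upper trapezoidal with nonzero diagonal.  No particular
   pivoting rule is imposed. *)
Definition qr_fact (R : realType) (m p q : nat)
    (A : 'M[R]_(m, p)) (Q : 'M[R]_(m, q)) (W : 'M[R]_(q, p)) : Prop :=
  [/\ Q^T *m Q = 1%:M, A = Q *m W &
      exists s : 'S_p,
        (forall (i : 'I_q) (j : 'I_p), (j < i)%N -> col_perm s W i j = 0) /\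
        (forall i : 'I_q, exists2 j : 'I_p, j = i :> nat &
           col_perm s W i j != 0)].

Definition qr (R : realType) (m p q : nat)
    (A : 'M[R]_(m, p)) (Q : 'M[R]_(m, q)) : Prop :=
  exists W : 'M[R]_(q, p), qr_fact A Q W.

Lemma qr_colspace (R : realType) (m p q : nat)
    (A : 'M[R]_(m, p)) (Q : 'M[R]_(m, q)) : qr A Q -> (Q^T :=: A^T)%MS.
Proof.
move=> [W [_ -> [s [Wtrig Wdiag]]]]; rewrite trmx_mul.
suff /eqP Wfree : row_free W.
  by apply/eqmx_sym/eqmxMfull; rewrite /row_full mxrank_tr Wfree.
rewrite -kermx_eq0; apply/eqP/row_matrixP => i; rewrite row0.
have /sub_kermxP := row_sub i (kermx W).
move: (row i _) => u uW; apply/rowP => k; rewrite mxE.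
suff H n : forall l : 'I_q, (l < n)%N -> u 0 l = 0 by exact: (H k.+1).
elim: n => // n IH {}k; rewrite ltnS leq_eqVlt => /orP[/eqP kn|/IH//].
have [j jk Wkj] := Wdiag k.
have /rowP/(_ (s j)) := uW; rewrite !mxE (bigD1 k)//= big1 ?addr0.
  by move/eqP; move: Wkj; rewrite mxE mulf_eq0 orbC => /negbTE -> /eqP.
move=> l lk; have [ln|nl] := ltnP l n; first by rewrite IH ?mul0r.
have := Wtrig l j; rewrite mxE => ->; first by rewrite mulr0.
by rewrite jk ltn_neqAle kn nl andbT -kn eq_sym.
Qed.

(* Y is an admissible value of the truncation of X at tolerance eps.  Hard and
   soft thresholding of the singular values are instances; being a relation,
   it lets different uses in the scheme choose different operators. *)
Definition truncates (R : realType) (m n : nat) (eps : R)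
    (X Y : 'M[R]_(m, n)) : Prop :=
  (\rank Y <= \rank X)%N /\ frob (X - Y) <= eps.

(* Y is the truncated SVD of the (formal sum) X: QR factorizations of the two
   concatenated outer factors, then truncation of the small core matrix. *)
Definition tsum (R : realType) (m n : nat) (eps : R) (X Y : lrmx R m n) :
  Prop :=
  exists (p q : nat) (QU : 'M[R]_(m, p)) (WU : 'M[R]_(p, lrk X))
         (QV : 'M[R]_(n, q)) (WV : 'M[R]_(q, lrk X)) (Z : lrmx R p q),
    [/\ qr_fact (lrU X) QU WU, qr_fact (lrV X) QV WV, svd Z,
        truncates eps (WU *m lrS X *m WV^T) (lrmat Z) &
        Y = LR (QU *m lrU Z) (lrS Z) (QV *m lrV Z)].

(* F(X, t) = \sum_j A_j X B_j^T + G(t), with G given in factored form. *)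
Record rhs (R : realType) (m1 m2 : nat) := Rhs {
  nterms : nat;
  rhsA : 'I_nterms -> 'M[R]_m1;
  rhsB : 'I_nterms -> 'M[R]_m2;
  rhsG : R -> lrmx R m1 m2 }.
Arguments rhsA {R m1 m2} r j.
Arguments rhsB {R m1 m2} r j.

Definition rhs_fun (R : realType) (m1 m2 : nat) (F : rhs R m1 m2)
    (X : 'M[R]_(m1, m2)) (t : R) : 'M[R]_(m1, m2) :=
  \sum_(j < nterms F) (rhsA F j *m X *m (rhsB F j)^T) + lrmat (rhsG F t).

Coercion rhs_fun : rhs >-> Funclass.

Definition rhs_lr (R : realType) (m1 m2 : nat) (F : rhs R m1 m2)
    (X : lrmx R m1 m2) (t : R) : lrmx R m1 m2 :=
  lradd (\big[@lradd R m1 m2/lr0 R m1 m2]_(j < nterms F)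
           LR (rhsA F j *m lrU X) (lrS X) (rhsB F j *m lrV X))
        (rhsG F t).

Lemma lrmat_rhs_lr (R : realType) (m1 m2 : nat) (F : rhs R m1 m2)
    (X : lrmx R m1 m2) (t : R) : lrmat (rhs_lr F X t) = F (lrmat X) t.
Proof.
rewrite /rhs_lr lrmatD /rhs_fun; congr (_ + _).
rewrite (big_morph _ (@lrmatD R m1 m2) (@lrmat0 R m1 m2)).
by apply: eq_bigr => j _; rewrite /lrmat /= trmx_mul !mulmxA.
Qed.

(* On [0, T]; the equation at 0 and T (one-sided derivatives) follows from its
   validity inside and from continuity up to the end points. *)
Definition solution (R : realType) (m1 m2 : nat) (F : rhs R m1 m2) (T : R)
    (X0 : 'M[R]_(m1, m2)) (X : R -> 'M[R]_(m1, m2)) : Prop :=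
  [/\ X 0 = X0, {within `[0, T], continuous X} &
      forall t, t \in `]0, T[ -> is_derive t 1 X (F (X t) t)].

Definition lipschitz_rhs (R : realType) (m1 m2 : nat) (F : rhs R m1 m2)
    (T L : R) : Prop :=
  forall (Y Z : 'M[R]_(m1, m2)) (s t : R), s \in `[0, T] -> t \in `[0, T] ->
    frob (F Y s - F Z t) <= L * frob (Y - Z) + L * `|s - t|.

(* Relative to a set D: for an affine F a bound on all matrices (D = setT) would
   force the linear part of F to vanish. *)
Definition bounded_rhs (R : realType) (m1 m2 : nat) (F : rhs R m1 m2)
    (D : set 'M[R]_(m1, m2)) (T B : R) : Prop :=
  forall (Y : 'M[R]_(m1, m2)) (t : R), D Y -> t \in `[0, T] ->
    frob (F Y t) <= B.

(* F has d derivatives with respect to t, the positive-order ones bounded by M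
   (F is affine, hence smooth, in its matrix argument, and these derivatives
   are those of G).  Naming the bound is needed to state the uniformity of the
   error constant: L and B alone do not control the quadrature error. *)
Definition smooth_rhs (R : realType) (m1 m2 : nat) (F : rhs R m1 m2)
    (d : nat) (T M : R) : Prop :=
  forall (Y : 'M[R]_(m1, m2)) (k : nat) (t : R), (k < d)%N -> t \in `]0, T[ ->
    derivable ((F Y)^`(k))%classic t 1 /\ frob ((F Y)^`(k.+1)%classic t) <= M.

(* Positions of the P + 1 nodes relative to the step: t_{n,m} = t_n + h c_m. *)
Definition rel_nodes (R : realType) (P : nat) (c : nat -> R) : Prop :=
  [/\ c 0%N = 0, c P = 1 & forall m, (m < P)%N -> c m < c m.+1].

Definition node (R : realType) (tn h : R) (c : nat -> R) (m : nat) : R :=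
  tn + h * c m.

Definition substep (R : realType) (t : nat -> R) (m : nat) : R :=
  t m.+1 - t m.

Definition weight (R : realType) (P : nat) (t : nat -> R) (m : nat)
    (s : 'I_P.+1) : R :=
  (substep t m)^-1 *
  (\int[lebesgue_measure]_(x in `[t m, t m.+1])
     \prod_(j < P.+1 | j != s) ((x - t j) / (t s - t j)))%R.

(* One substep of stage 1, from Y at time t to Y' at time t'. *)
Definition stage1_substep (R : realType) (m1 m2 : nat) (F : rhs R m1 m2)
    (es ef t t' : R) (Y Y' : lrmx R m1 m2) : Prop :=
  exists (YF : lrmx R m1 m2) (Kx : 'M[R]_(m1, lrk Y)) (Lx : 'M[R]_(m2, lrk Y))
         (p q : nat) (U : 'M[R]_(m1, p)) (V : 'M[R]_(m2, q))
         (S : 'M[R]_(p, q)) (Z : lrmx R p q),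
    [/\ tsum ef (rhs_lr F Y t) YF,
        Kx = lrmat Y *m lrV Y
             + (t' - t) *: (F (Kx *m (lrV Y)^T) t' *m lrV Y) /\
        Lx = (lrmat Y)^T *m lrU Y
             + (t' - t) *: ((F (lrU Y *m Lx^T) t')^T *m lrU Y),
        qr (row_mx (row_mx (lrU Y) (lrU YF)) Kx) U /\
        qr (row_mx (row_mx (lrV Y) (lrV YF)) Lx) V,
        S = U^T *m lrmat Y *m V
            + (t' - t) *: (U^T *m F (U *m S *m V^T) t' *m V) &
        [/\ svd Z, truncates es S (lrmat Z) &
            Y' = LR (U *m lrU Z) (lrS Z) (V *m lrV Z)]].

(* The residual correction at the m-th substep, from the truncated values YF_s
   of F at the nodes. *)
Definition residual (R : realType) (m1 m2 P : nat) (t : nat -> R)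
    (YF : nat -> lrmx R m1 m2) (m : nat) : lrmx R m1 m2 :=
  lradd (lrscale (- substep t m) (YF m.+1))
        (\big[@lradd R m1 m2/lr0 R m1 m2]_(s < P.+1)
           lrscale (substep t m * weight t m s) (YF s)).

(* One substep of a correction sweep, from Y at time t to Y' at time t';
   YF is the truncated value of F at t' from the previous sweep, YR the
   truncated residual. *)
Definition correction_substep (R : realType) (m1 m2 : nat) (F : rhs R m1 m2)
    (es t t' : R) (YF YR Y Y' : lrmx R m1 m2) : Prop :=
  exists (p q : nat) (U : 'M[R]_(m1, p)) (V : 'M[R]_(m2, q))
         (S : 'M[R]_(p, q)) (Z : lrmx R p q),
    [/\ qr (row_mx (row_mx (lrU Y) (lrU YF)) (lrU YR)) U,
        qr (row_mx (row_mx (lrV Y) (lrV YF)) (lrV YR)) V,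
        S = U^T *m lrmat Y *m V
            + (t' - t) *: (U^T *m F (U *m S *m V^T) t' *m V)
            + U^T *m lrmat YR *m V &
        [/\ svd Z, truncates es S (lrmat Z) &
            Y' = LR (U *m lrU Z) (lrS Z) (V *m lrV Z)]].

(* Xout is a result of one step with nodes t_0 < ... < t_P from the stored
   value Xn.  X k m, YF k m, YR k m are the iterate, the truncated value of F
   and the truncated residual with superscript k at node m.  The tolerance
   sequences esk, efk, erk are indexed by their superscripts, so that esk is
   used from 2 on. *)
Definition sdc_mbug (R : realType) (m1 m2 : nat) (F : rhs R m1 m2)
    (P K : nat) (t : nat -> R) (es ef : R) (esk efk erk : nat -> R)
    (Xn Xout : lrmx R m1 m2) : Prop :=
  exists X YF YR : nat -> nat -> lrmx R m1 m2,
    [/\ forall k, (1 <= k <= K.+1)%N -> X k 0%N = Xn,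
        forall m, (m < P)%N ->
          stage1_substep F es ef (t m) (t m.+1) (X 1%N m) (X 1%N m.+1),
        forall k m, (1 <= k <= K)%N -> (m <= P)%N ->
          tsum (efk k) (rhs_lr F (X k m) (t m)) (YF k m),
        forall k m, (1 <= k <= K)%N -> (m < P)%N ->
          tsum (erk k) (residual P t (YF k) m) (YR k m) /\
          correction_substep F (esk k.+1) (t m) (t m.+1)
            (YF k m.+1) (YR k m) (X k.+1 m) (X k.+1 m.+1) &
        Xout = X K.+1 P].

(* Main.v *)
Require Import Defs.
From HB Require Import structures.
From mathcomp Require Import all_boot all_order all_algebra all_fingroup.
From mathcomp Require Import all_classical all_reals all_analysis.
From mathcomp Require Import ring lra.

Set Implicit Arguments.
Unset Strict Implicit.
Unset Printing Implicit Defensive.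

Import Order.TTheory GRing.Theory Num.Theory.
Import numFieldNormedType.Exports.

Local Open Scope classical_set_scope.
Local Open Scope ring_scope.

(** A correction sweep is an implicit Euler sweep, projected onto adaptively
    chosen column and row spaces, plus a residual that replaces the Euler
    increment of the previous iterate by a high-order quadrature. Three facts
    carry the estimate.

    - The projection costs only what is truncated. The spaces contain the
      current iterate, the truncated residual (if any) and a low-rank matrix
      close to [F (X t') t']; the projector [A |-> U U^T A V V^T] is
      orthogonal for the Frobenius inner product, so both it and its
      complement are contractions, and it moves [F (X t') t'] by at most the
      distance to that low-rank matrix. Since the projected increment contains
      [F] at the unknown only once, its error is absorbed at the price of a
      factor [1 / (1 - h L)], for every [h L < 1] ([projected_step]).

    - The exact solution makes the quadrature accurate. As [F] is affine in
      its matrix argument, the derivatives of [u |-> F (X u) u] obey a linear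
      recursion driven by the derivatives of [F 0], hence are bounded in terms
      of [L], [B], [M] only ([frob_flow_deriv]), and interpolation at [P + 1]
      nodes integrates [F (X u) u] over a substep with error O(h^(P+2))
      ([quadrature_error], [solution_quadrature]). Matrix estimates are read
      off from scalar ones by pairing with an arbitrary matrix [W], so that
      Rolle's theorem and the mean value theorem suffice.

    - A sweep gains one power of [h]. The previous iterate enters only through
      [h F], so if its error is [E], the new error is O(h E + h^(P+2) +
      tolerances) ([correction_sweep]); the first stage is a projected
      implicit Euler sweep of error O(h^2 + tolerances) ([stage1_sweep]).
      Induction on the number of sweeps gives the order [minn K.+2 P.+2], and
      the tolerances accumulate according to [tol_acc]. *)

(** * The Frobenius inner product and norm *)

Definition mxdot (R : realType) (m n : nat) (A B : 'M[R]_(m, n)) : R :=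
  \sum_i \sum_j A i j * B i j.

Lemma mxdotE (R : realType) (m n : nat) (A B : 'M[R]_(m, n)) :
  mxdot A B = \tr (A *m B^T).
Proof.
by apply: eq_bigr => i _; rewrite mxE; apply: eq_bigr => j _; rewrite mxE.
Qed.

Lemma mxdotC (R : realType) (m n : nat) (A B : 'M[R]_(m, n)) :
  mxdot A B = mxdot B A.
Proof. by do 2![apply: eq_bigr => ? _]; rewrite mulrC. Qed.

Lemma mxdotDr (R : realType) (m n : nat) (A B C : 'M[R]_(m, n)) :
  mxdot A (B + C) = mxdot A B + mxdot A C.
Proof. by rewrite !mxdotE linearD mulmxDr linearD. Qed.

Lemma mxdotZr (R : realType) (m n : nat) (a : R) (A B : 'M[R]_(m, n)) :
  mxdot A (a *: B) = a * mxdot A B.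
Proof. by rewrite !mxdotE linearZ -scalemxAr linearZ. Qed.

Lemma mxdotNr (R : realType) (m n : nat) (A B : 'M[R]_(m, n)) :
  mxdot A (- B) = - mxdot A B.
Proof. by rewrite -scaleN1r mxdotZr mulN1r. Qed.

Lemma mxdotBr (R : realType) (m n : nat) (A B C : 'M[R]_(m, n)) :
  mxdot A (B - C) = mxdot A B - mxdot A C.
Proof. by rewrite mxdotDr mxdotNr. Qed.

Lemma mxdot_sumr (R : realType) (m n p : nat) (A : 'M[R]_(m, n))
    (B : 'I_p -> 'M[R]_(m, n)) :
  mxdot A (\sum_i B i) = \sum_i mxdot A (B i).
Proof.
apply: (big_morph (mxdot A)); first exact: mxdotDr.
by rewrite -(scale0r 0) mxdotZr mul0r.
Qed.

Lemma mxdot_mulmx (R : realType) (m n p q : nat) (P : 'M[R]_(m, p))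
    (A : 'M[R]_(p, q)) (Q : 'M[R]_(q, n)) (B : 'M[R]_(m, n)) :
  mxdot (P *m A *m Q) B = mxdot A (P^T *m B *m Q^T).
Proof.
by rewrite !mxdotE !trmx_mul !trmxK -!mulmxA mxtrace_mulC !mulmxA.
Qed.

Lemma frobE (R : realType) (m n : nat) (A : 'M[R]_(m, n)) :
  frob A = Num.sqrt (mxdot A A).
Proof. by []. Qed.

Lemma mxdot_ge0 (R : realType) (m n : nat) (A : 'M[R]_(m, n)) :
  0 <= mxdot A A.
Proof. by do 2![apply: sumr_ge0 => ? _]; rewrite -expr2 sqr_ge0. Qed.

Lemma frob_ge0 (R : realType) (m n : nat) (A : 'M[R]_(m, n)) : 0 <= frob A.
Proof. exact: sqrtr_ge0. Qed.

Lemma frob_sqr (R : realType) (m n : nat) (A : 'M[R]_(m, n)) :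
  frob A ^+ 2 = mxdot A A.
Proof. by rewrite frobE sqr_sqrtr ?mxdot_ge0. Qed.

Lemma frob_eq0 (R : realType) (m n : nat) (A : 'M[R]_(m, n)) :
  frob A = 0 -> A = 0.
Proof.
move=> a0; apply/matrixP => i j; rewrite mxE.
have /eqP := frob_sqr A; rewrite a0 expr0n eq_sym psumr_eq0; last first.
  by move=> k _; apply: sumr_ge0 => l _; rewrite -expr2 sqr_ge0.
move=> /allP/(_ i (mem_index_enum i))/=; rewrite psumr_eq0; last first.
  by move=> l _; rewrite -expr2 sqr_ge0.
by move=> /allP/(_ j (mem_index_enum j))/=; rewrite mulf_eq0 orbb => /eqP.
Qed.

Lemma frob0 (R : realType) (m n : nat) : frob (0 : 'M[R]_(m, n)) = 0.
Proof. by rewrite frobE -{2}(scale0r 0) mxdotZr mul0r sqrtr0. Qed.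

(** Cauchy-Schwarz, from the sign of the square norm of
    [frob B *: A - frob A *: B]. *)
Lemma mxdot_le_frob (R : realType) (m n : nat) (A B : 'M[R]_(m, n)) :
  mxdot A B <= frob A * frob B.
Proof.
have mxdot0 (C : 'M[R]_(m, n)) : mxdot C 0 = 0.
  by rewrite -(scale0r 0) mxdotZr mul0r.
have [/frob_eq0 ->|a0] := eqVneq (frob A) 0.
  by rewrite mxdotC mxdot0 frob0 mul0r.
have [/frob_eq0 ->|b0] := eqVneq (frob B) 0.
  by rewrite mxdot0 frob0 mulr0.
have ab_gt0 : 0 < frob A * frob B by rewrite mulr_gt0// lt_def ?a0 ?b0 frob_ge0.
have := mxdot_ge0 (frob B *: A - frob A *: B).
rewrite mxdotBr !mxdotZr !(mxdotC _ A) !(mxdotC _ B).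
rewrite !mxdotBr !mxdotZr (mxdotC B A) -!frob_sqr.
rewrite [X in 0 <= X](_ : _ =
  2 * (frob A * frob B) * (frob A * frob B - mxdot A B)); last by ring.
by rewrite pmulr_rge0 ?subr_ge0// mulr_gt0.
Qed.

Lemma frobD (R : realType) (m n : nat) (A B : 'M[R]_(m, n)) :
  frob (A + B) <= frob A + frob B.
Proof.
rewrite -(ler_pXn2r (n := 2)) ?nnegrE ?addr_ge0 ?frob_ge0//.
rewrite frob_sqr mxdotDr !(mxdotC _ A) !(mxdotC _ B) !mxdotDr -!frob_sqr.
have := mxdot_le_frob A B; rewrite (mxdotC B A); lra.
Qed.

Lemma frobZ (R : realType) (m n : nat) (a : R) (A : 'M[R]_(m, n)) :
  frob (a *: A) = `|a| * frob A.
Proof.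
rewrite !frobE mxdotZr mxdotC mxdotZr mulrA -expr2 sqrtrM ?sqr_ge0//.
by rewrite sqrtr_sqr.
Qed.

Lemma frobN (R : realType) (m n : nat) (A : 'M[R]_(m, n)) :
  frob (- A) = frob A.
Proof. by rewrite -scaleN1r frobZ normrN1 mul1r. Qed.

Lemma frob_distC (R : realType) (m n : nat) (A B : 'M[R]_(m, n)) :
  frob (A - B) = frob (B - A).
Proof. by rewrite -frobN opprB. Qed.

Lemma frob_dist_trans (R : realType) (m n : nat) (A B C : 'M[R]_(m, n)) :
  frob (A - C) <= frob (A - B) + frob (B - C).
Proof. by rewrite -(subrKA B) frobD. Qed.

Lemma frob_sum (R : realType) (m n p : nat) (A : 'I_p -> 'M[R]_(m, n)) :
  frob (\sum_i A i) <= \sum_i frob (A i).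
Proof.
elim/big_ind2: _ => [|A1 a1 A2 a2 le1 le2|//]; first by rewrite frob0.
by rewrite (le_trans (frobD _ _))// lerD.
Qed.

Lemma frob_isometry (R : realType) (m n p q : nat) (U : 'M[R]_(m, p))
    (V : 'M[R]_(n, q)) (A : 'M[R]_(p, q)) :
  U^T *m U = 1%:M -> V^T *m V = 1%:M -> frob (U *m A *m V^T) = frob A.
Proof.
move=> UU VV; rewrite !frobE mxdot_mulmx trmxK !mulmxA UU mul1mx.
by rewrite -mulmxA VV mulmx1.
Qed.

(** The orthogonal projection onto the matrices with column space in that of
    [U] and row space in that of [V]; the bracketing is that of the reduced
    core matrix [U^T A V] of the scheme. *)
Definition proj2 (R : realType) (m n p q : nat) (U : 'M[R]_(m, p))
    (V : 'M[R]_(n, q)) (A : 'M[R]_(m, n)) : 'M[R]_(m, n) :=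
  U *m (U^T *m A *m V) *m V^T.

Lemma proj2D (R : realType) (m n p q : nat) (U : 'M[R]_(m, p))
    (V : 'M[R]_(n, q)) (A B : 'M[R]_(m, n)) :
  proj2 U V (A + B) = proj2 U V A + proj2 U V B.
Proof. by rewrite /proj2 !(mulmxDr, mulmxDl). Qed.

Lemma proj2Z (R : realType) (m n p q : nat) (U : 'M[R]_(m, p))
    (V : 'M[R]_(n, q)) (a : R) (A : 'M[R]_(m, n)) :
  proj2 U V (a *: A) = a *: proj2 U V A.
Proof. by rewrite /proj2 -!(scalemxAr, scalemxAl). Qed.

Lemma proj2B (R : realType) (m n p q : nat) (U : 'M[R]_(m, p))
    (V : 'M[R]_(n, q)) (A B : 'M[R]_(m, n)) :
  proj2 U V (A - B) = proj2 U V A - proj2 U V B.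
Proof. by rewrite -scaleN1r proj2D proj2Z scaleN1r. Qed.

(** [proj2 U V] is symmetric and idempotent, so a matrix splits orthogonally
    into its projection and the remainder; in particular both parts are no
    longer than the matrix itself. *)
Lemma frob_proj2_pythagoras (R : realType) (m n p q : nat) (U : 'M[R]_(m, p))
    (V : 'M[R]_(n, q)) (A : 'M[R]_(m, n)) :
  U^T *m U = 1%:M -> V^T *m V = 1%:M ->
  frob (proj2 U V A) ^+ 2 + frob (A - proj2 U V A) ^+ 2 = frob A ^+ 2.
Proof.
move=> UU VV; have selfdot : mxdot (proj2 U V A) (proj2 U V A)
                       = mxdot A (proj2 U V A).
  rewrite {1}/proj2 !mulmxA -(mulmxA _ V) mxdot_mulmx !trmx_mul !trmxK.
  rewrite /proj2 !mulmxA -(mulmxA U U^T U) UU mulmx1.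
  by rewrite -(mulmxA _ V^T V) VV mulmx1.
rewrite !frob_sqr mxdotBr !(mxdotC _ A) !(mxdotC _ (proj2 _ _ _)).
by rewrite !mxdotBr selfdot (mxdotC _ A); ring.
Qed.

Lemma frob_proj2 (R : realType) (m n p q : nat) (U : 'M[R]_(m, p))
    (V : 'M[R]_(n, q)) (A : 'M[R]_(m, n)) :
  U^T *m U = 1%:M -> V^T *m V = 1%:M -> frob (proj2 U V A) <= frob A.
Proof.
move=> UU VV; rewrite -(ler_pXn2r (n := 2)) ?nnegrE ?frob_ge0//.
by rewrite -(frob_proj2_pythagoras A UU VV) lerDl sqr_ge0.
Qed.

Lemma frob_proj2C (R : realType) (m n p q : nat) (U : 'M[R]_(m, p))
    (V : 'M[R]_(n, q)) (A : 'M[R]_(m, n)) :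
  U^T *m U = 1%:M -> V^T *m V = 1%:M -> frob (A - proj2 U V A) <= frob A.
Proof.
move=> UU VV; rewrite -(ler_pXn2r (n := 2)) ?nnegrE ?frob_ge0//.
by rewrite -(frob_proj2_pythagoras A UU VV) lerDr sqr_ge0.
Qed.

(** The duality that turns scalar mean value estimates into matrix ones: test
    the hypothesis at [W = A]. *)
Lemma mxdot_le_dual (R : realType) (m n : nat) (A : 'M[R]_(m, n)) (b : R) :
  0 <= b -> (forall W : 'M[R]_(m, n), mxdot W A <= frob W * b) -> frob A <= b.
Proof.
move=> b0 /(_ A); rewrite -frob_sqr expr2.
have := frob_ge0 A; rewrite le_eqVlt => /predU1P[<- //|a0].
by rewrite ler_pM2l.
Qed.

(** * Interpolation error by repeated use of Rolle's theorem *)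

Lemma ltn_step_le (R : realType) (n : nat) (y : nat -> R) (i j : nat) :
  (forall k, (k < n)%N -> y k < y k.+1) -> (i <= j)%N -> (j <= n)%N ->
  y i <= y j.
Proof.
move=> ylt; elim: j => [|j IH]; first by rewrite leqn0 => /eqP ->.
rewrite leq_eqVlt ltnS => /predU1P[-> //|ij] jn.
exact: le_trans (IH ij (ltnW jn)) (ltW (ylt _ jn)).
Qed.

Lemma ltn_step_lt (R : realType) (n : nat) (y : nat -> R) (i j : nat) :
  (forall k, (k < n)%N -> y k < y k.+1) -> (i < j)%N -> (j <= n)%N ->
  y i < y j.
Proof.
move=> ylt ij jn; apply: lt_le_trans (ylt i (leq_trans ij jn)) _.
exact: ltn_step_le ylt ij jn.
Qed.

Lemma rolle_derive (R : realType) (f df : R -> R) (a b : R) :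
  a < b -> {within `[a, b], continuous f} ->
  (forall x, x \in `]a, b[ -> is_derive x 1 f (df x)) -> f a = f b ->
  exists2 x, x \in `]a, b[ & df x = 0.
Proof.
move=> ab fc fdf fab.
have [x xab] := MVT ab fdf fc; rewrite fab subrr => /esym/eqP.
by rewrite mulf_eq0 subr_eq0 (gt_eqF ab) orbF => /eqP; exists x.
Qed.

(** [D k] stands for the [k]-th derivative of [D 0]. Rolle's theorem between
    consecutive zeros gives one zero less for the next derivative; the new
    zeros are interior, so that from the second derivative on continuity on the
    closed interval comes from differentiability. *)
Lemma rolle_zeros (R : realType) (n : nat) (D : nat -> R -> R) (z : nat -> R)
    (a b : R) :
  (forall i, (i <= n.+1)%N -> z i \in `[a, b]) ->
  (forall i, (i < n.+1)%N -> z i < z i.+1) ->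
  {within `[a, b], continuous (D 0%N)} ->
  (forall k x, (k <= n)%N -> x \in `]a, b[ ->
     is_derive x 1 (D k) (D k.+1 x)) ->
  (forall i, (i <= n.+1)%N -> D 0%N (z i) = 0) ->
  exists2 x, x \in `]a, b[ & D n.+1 x = 0.
Proof.
elim: n D z a b => [|n IH] D z a b zab zlt D0 DS Dz.
  have z0 := zab 0%N isT; have z1 := zab 1%N isT.
  have sub x : x \in `]z 0%N, z 1%N[ -> x \in `]a, b[.
    by apply: subset_itvW; rewrite ?(itvP z0) ?(itvP z1).
  have [||x xz Dx] := rolle_derive (zlt 0%N isT) _
      (fun x xz => DS 0%N x isT (sub x xz)).
  - apply: continuous_subspaceW D0 => x /=.
    by apply: subset_itv; rewrite bnd_simp ?(itvP z0) ?(itvP z1).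
  - by rewrite !Dz.
  - by exists x => //; exact: sub.
have /choice[y yP] : forall i, exists y, (i <= n.+1)%N ->
    [/\ y \in `]z i, z i.+1[, y \in `]a, b[ & D 1%N y = 0].
  move=> i; have [iln|_] := leqP i n.+1; last by exists 0.
  have z0 := zab i (leqW iln); have z1 := zab i.+1 iln.
  have sub x : x \in `]z i, z i.+1[ -> x \in `]a, b[.
    by apply: subset_itvW; rewrite ?(itvP z0) ?(itvP z1).
  have [||x xz Dx] := rolle_derive (zlt i iln) _
      (fun x xz => DS 0%N x isT (sub x xz)).
  - apply: continuous_subspaceW D0 => x /=.
    by apply: subset_itv; rewrite bnd_simp ?(itvP z0) ?(itvP z1).
  - by rewrite !Dz// leqW.
  - by exists x => //; split=> //; exact: sub.
have ylt i : (i < n.+1)%N -> y i < y i.+1.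
  move=> iln; have [yi _ _] := yP i (ltnW iln).
  have [yi1 _ _] := yP i.+1 iln.
  by apply: lt_trans (_ : z i.+1 < _); rewrite ?(itvP yi) ?(itvP yi1).
have sub x : x \in `[y 0%N, y n.+1] -> x \in `]a, b[.
  have [_ y0 _] := yP 0%N isT; have [_ y1 _] := yP n.+1 (leqnn _).
  by apply: subset_itv; rewrite bnd_simp ?(itvP y0) ?(itvP y1).
have dD k x : (k <= n)%N -> x \in `]y 0%N, y n.+1[ ->
    is_derive x 1 (D k.+1) (D k.+2 x).
  by move=> kn /subset_itv_oo_cc/sub; exact: DS.
have [| | | |x xy Dx] := IH (fun k => D k.+1) y _ _ _ _ _ dD.
- move=> i iln; rewrite in_itv/=.
  by rewrite (ltn_step_le ylt (leq0n i) iln) (ltn_step_le ylt iln).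
- exact: ylt.
- apply: derivable_within_continuous => x /sub xab.
  by have [] := DS 1%N x isT xab.
- by move=> i /yP[].
- by exists x => //; exact/sub/subset_itv_oo_cc.
Qed.

Lemma derivn_top (R : realType) (n : nat) (p : {poly R}) :
  (size p <= n.+1)%N -> p^`(n) = (p`_n *+ n`!)%:P.
Proof.
move=> pn; apply/polyP => -[|i]; rewrite coef_derivn coefC/=.
  by rewrite addn0 ffactnn.
by rewrite nth_default ?mul0rn// (leq_trans pn)// addnS ltnS leq_addr.
Qed.

(** Subtract from [D 0] the polynomial that interpolates it at the nodes and
    also at [x], namely [p] plus a multiple [k] of the node polynomial. The
    difference has [P + 2] zeros, so its derivative of order [P + 1] vanishes
    somewhere; there [D P.+1] equals [k *+ (P.+1)`!]. The factorial is dropped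
    from the bound. *)
Lemma interp_error (R : realType) (P m : nat) (D : nat -> R -> R) (t : nat -> R)
    (p : {poly R}) (b x : R) :
  (forall i, (i < P)%N -> t i < t i.+1) -> (m < P)%N ->
  {within `[t 0%N, t P], continuous (D 0%N)} ->
  (forall k y, (k <= P)%N -> y \in `]t 0%N, t P[ ->
     is_derive y 1 (D k) (D k.+1 y)) ->
  (forall y, y \in `]t 0%N, t P[ -> `|D P.+1 y| <= b) ->
  (size p <= P.+1)%N -> (forall i, (i <= P)%N -> p.[t i] = D 0%N (t i)) ->
  x \in `]t m, t m.+1[ -> `|D 0%N x - p.[x]| <= b * (t P - t 0%N) ^+ P.+1.
Proof.
move=> tlt mP D0 DS Db sp pt xm.
have tin i : (i <= P)%N -> t i \in `[t 0%N, t P].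
  move=> iP; rewrite in_itv/= (ltn_step_le tlt (leq0n i) iP).
  exact: ltn_step_le tlt iP _.
have t0m := tin _ (ltnW mP); have t1m := tin _ mP.
have xin : x \in `]t 0%N, t P[.
  by apply: subset_itvW xm; rewrite ?(itvP t0m) ?(itvP t1m).
pose w : {poly R} := \prod_(i < P.+1) ('X - (t i)%:P).
have wx : w.[x] = \prod_(i < P.+1) (x - t i).
  by rewrite horner_prod; apply: eq_bigr => i _; rewrite hornerXsubC.
have wx0 : w.[x] != 0.
  rewrite wx; apply/prodf_neq0 => i _; rewrite subr_eq0.
  have [im|mi] := leqP i m.
    rewrite gt_eqF// (le_lt_trans (ltn_step_le tlt im (ltnW mP)))//.
    by rewrite (itvP xm).
  rewrite lt_eqF//; apply: lt_le_trans (ltn_step_le tlt mi _).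
    by rewrite (itvP xm).
  by rewrite -ltnS.
pose k := (D 0%N x - p.[x]) / w.[x].
pose r := p + k *: w.
have sw : size w = P.+2 by rewrite /w -big_enum size_prod_XsubC size_enum_ord.
have sr : (size r <= P.+2)%N.
  rewrite (leq_trans (size_polyD _ _))// geq_max (leq_trans sp)//=.
  by rewrite (leq_trans (size_scale_leq _ _))// sw.
have rP : r`_P.+1 = k.
  rewrite coefD coefZ nth_default// add0r.
  have : w \is monic by exact: monic_prod_XsubC.
  by rewrite monicE lead_coefE sw /= => /eqP ->; rewrite mulr1.
(* The P + 2 zeros in increasing order: x is inserted after the node m. *)
pose z i := if (i <= m)%N then t i else if i == m.+1 then x else t i.-1.
have dE i y : (i <= P)%N -> y \in `]t 0%N, t P[ ->
    is_derive y 1 (D i \- horner r^`(i)) (D i.+1 y - r^`(i.+1).[y]).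
  by move=> iP yin; rewrite derivnS; apply: is_deriveB; exact: DS.
have [| | | |y yin] := rolle_zeros (D := fun i => D i \- horner r^`(i))
  (z := z) _ _ _ dE.
- move=> i iP; rewrite /z; case: leqP => im.
    by rewrite tin// (leq_trans im (ltnW mP)).
  case: eqP => _; first exact: subset_itv_oo_cc.
  by rewrite tin//; case: i iP {im}.
- move=> i iP; rewrite /z; have [im|mi|im] := ltngtP i m.
  + by apply: tlt; exact: ltn_trans im mP.
  + case: (eqVneq i m.+1) => [->|im].
      by rewrite eqSS gtn_eqF//= (itvP xm).
    rewrite eqSS (gtn_eqF mi)/=.
    have i0 : (0 < i)%N by exact: leq_ltn_trans mi.
    by rewrite -{2}(prednK i0) tlt// prednK.
  + by rewrite im eqxx (itvP xm).
- move=> y; apply: continuousB; first exact: D0.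
  rewrite derivn0; apply: continuous_subspaceT => ?.
  exact: continuous_horner.
- move=> i iP; rewrite /= hornerD hornerZ /z.
  have zt j : (j <= P)%N -> D 0%N (t j) - (p.[t j] + k * w.[t j]) = 0.
    move=> jP; rewrite pt// [w.[_]]horner_prod.
    have jP' : (j < P.+1)%N by [].
    rewrite (bigD1 (Ordinal jP'))//= hornerXsubC subrr mul0r mulr0 addr0.
    by rewrite subrr.
  case: leqP => im; first by rewrite zt// (leq_trans im (ltnW mP)).
  case: eqP => _; last by rewrite zt//; case: i iP {im}.
  by rewrite /k divfK// subrKC subrr.
move=> Dr0; have {Dr0} : D P.+1 y - r^`(P.+1).[y] = 0 by [].
rewrite derivn_top// rP hornerC => /eqP; rewrite subr_eq0 => /eqP Dk.
have kb : `|k| <= b.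
  apply: le_trans (Db _ yin); rewrite Dk normrMn -[leLHS]mulr1n.
  by rewrite ler_wpMn2l// fact_gt0.
rewrite -[_ - _](divfK wx0) -/k normrM ler_pM// wx normr_prod.
rewrite -[X in _ ^+ X]card_ord -prodr_const; apply: ler_prod => i _.
rewrite normr_ge0/= ler_norml; have := tin i (ltn_ord i).
by rewrite in_itv/=; move: xin; rewrite in_itv/=; lra.
Qed.

(** * Quadrature by integrated Lagrange polynomials *)

Lemma antideriv (R : realType) (p : {poly R}) : {q : {poly R} | q^`() = p}.
Proof.
exists (\poly_(i < (size p).+1) (p`_i.-1 / i%:R)).
apply/polyP => i; rewrite coef_deriv coef_poly ltnS /=.
case: ltnP => [_|pi]; last by rewrite mul0rn nth_default.
by rewrite -[LHS]mulr_natr divfK// pnatr_eq0.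
Qed.

Lemma Rintegral_poly (R : realType) (q : {poly R}) (a b : R) : a < b ->
  (\int[lebesgue_measure]_(x in `[a, b]) q^`().[x])%R = q.[b] - q.[a].
Proof.
move=> ab; rewrite /Rintegral (@continuous_FTC2 _ _ (horner q))//.
- by apply: continuous_subspaceT => ?; exact: continuous_horner.
- split.
  + by move=> x _; exact: derivable_horner.
  + by apply: cvg_at_right_filter; exact: continuous_horner.
  + by apply: cvg_at_left_filter; exact: continuous_horner.
- by move=> x _; rewrite derivE.
Qed.

Definition lagrange (R : realType) (P : nat) (t : nat -> R) (s : 'I_P.+1) :
    {poly R} :=
  \prod_(j < P.+1 | j != s) ((t s - t j)^-1 *: ('X - (t j)%:P)).

Lemma lagrangeE (R : realType) (P : nat) (t : nat -> R) (s : 'I_P.+1) (x : R) :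
  (lagrange t s).[x] = \prod_(j < P.+1 | j != s) ((x - t j) / (t s - t j)).
Proof.
rewrite horner_prod; apply: eq_bigr => j _.
by rewrite hornerZ hornerXsubC mulrC.
Qed.

Lemma size_lagrange (R : realType) (P : nat) (t : nat -> R) (s : 'I_P.+1) :
  (size (lagrange t s) <= P.+1)%N.
Proof.
rewrite (leq_trans (size_prod_leq _ _))// leq_subLR.
have -> : #|[pred j : 'I_P.+1 | j != s]| = P by rewrite cardC1 card_ord.
rewrite addnS ltnS addnn -muln2 -[X in (X * _)%N](_ : #|predC1 s| = P).
  rewrite -sum_nat_const leq_sum// => j _.
  by rewrite (leq_trans (size_scale_leq _ _))// size_XsubC.
by rewrite cardC1 card_ord.
Qed.

Lemma weight_antideriv (R : realType) (P m : nat) (t : nat -> R)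
    (s : 'I_P.+1) (q : {poly R}) : t m < t m.+1 -> q^`() = lagrange t s ->
  substep t m * weight t m s = q.[t m.+1] - q.[t m].
Proof.
move=> tm qs; rewrite /weight mulVKf ?subr_eq0 ?gt_eqF//.
rewrite -(Rintegral_poly q tm) qs; congr (Rintegral _ _ _).
by apply/funext => x; rewrite lagrangeE.
Qed.

(** By the mean value theorem the weight is a value of the Lagrange polynomial
    in the substep, where each factor is at most the whole step over the
    distance of two nodes. *)
Lemma weight_bound (R : realType) (P m : nat) (t : nat -> R) (s : 'I_P.+1) :
  (forall i, (i < P)%N -> t i < t i.+1) -> (m < P)%N ->
  `|weight t m s| <= \prod_(j < P.+1 | j != s) ((t P - t 0%N) / `|t s - t j|).
Proof.
move=> tlt mP; have tm := tlt _ mP.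
have [q qs] := antideriv (lagrange t s).
have w0 : 0 < substep t m by rewrite subr_gt0.
rewrite -(ler_pM2l w0) -[X in X * `|_|](gtr0_norm w0) -normrM.
rewrite (weight_antideriv tm qs).
have [x xm ->] := MVT tm (fun x _ => is_derive_poly q x)
  (continuous_subspaceT (@continuous_horner _ q)).
rewrite normrM (gtr0_norm w0) mulrC ler_wpM2l ?(ltW w0)//.
rewrite qs lagrangeE normr_prod; apply: ler_prod => j _.
rewrite normr_ge0/= normrM normfV ler_wpM2r ?invr_ge0//.
have jP : (j <= P)%N by rewrite -ltnS.
have := ltn_step_le tlt (leq0n j) jP; have := ltn_step_le tlt jP (leqnn P).
have := ltn_step_le tlt (leq0n m) (ltnW mP).
have := ltn_step_le tlt mP (leqnn P).
by move: xm; rewrite ler_norml in_itv/=; lra.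
Qed.

(** The quadrature is the increment of an antiderivative [Q] of the
    interpolation polynomial, and the mean value theorem for [Q \- phi] turns
    the error of the increments into the interpolation error at one interior
    point. *)
Lemma quadrature_error (R : realType) (P m : nat) (phi : R -> R)
    (D : nat -> R -> R) (t : nat -> R) (b : R) :
  (forall i, (i < P)%N -> t i < t i.+1) -> (m < P)%N ->
  {within `[t 0%N, t P], continuous phi} ->
  (forall y, y \in `]t 0%N, t P[ -> is_derive y 1 phi (D 0%N y)) ->
  {within `[t 0%N, t P], continuous (D 0%N)} ->
  (forall k y, (k <= P)%N -> y \in `]t 0%N, t P[ ->
     is_derive y 1 (D k) (D k.+1 y)) ->
  (forall y, y \in `]t 0%N, t P[ -> `|D P.+1 y| <= b) ->
  `|\sum_(s < P.+1) substep t m * weight t m s * D 0%N (t s)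
     - (phi (t m.+1) - phi (t m))|
    <= b * (t P - t 0%N) ^+ P.+1 * substep t m.
Proof.
move=> tlt mP phic dphi D0 DS Db; have tm := tlt _ mP.
pose q (s : 'I_P.+1) := sval (antideriv (lagrange t s)).
have qE s : (q s)^`() = lagrange t s by rewrite /q; case: antideriv.
pose p := \sum_(s < P.+1) D 0%N (t s) *: lagrange t s.
pose Q := \sum_(s < P.+1) D 0%N (t s) *: q s.
have Qp : Q^`() = p.
  rewrite /Q (big_morph _ (@derivD R) (deriv0 R)).
  by apply: eq_bigr => s _; rewrite derivZ qE.
have -> : \sum_(s < P.+1) substep t m * weight t m s * D 0%N (t s)
    = Q.[t m.+1] - Q.[t m].
  rewrite !horner_sum -sumrB; apply: eq_bigr => s _.
  by rewrite (weight_antideriv tm (qE s)) !hornerZ -mulrBr mulrC.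
have sp : (size p <= P.+1)%N.
  rewrite (leq_trans (size_sum _ _ _))//; apply/bigmax_leqP => s _.
  by rewrite (leq_trans (size_scale_leq _ _))// size_lagrange.
have tinj (i j : nat) : (i <= P)%N -> (j <= P)%N -> i != j -> t i != t j.
  move=> iP jP; rewrite neq_ltn => /orP[ij|ji].
    by rewrite lt_eqF// (ltn_step_lt tlt ij).
  by rewrite gt_eqF// (ltn_step_lt tlt ji).
have pt i : (i <= P)%N -> p.[t i] = D 0%N (t i).
  move=> iP; have iP' : (i < P.+1)%N by [].
  rewrite horner_sum (bigD1 (Ordinal iP'))//= hornerZ lagrangeE.
  rewrite big1 ?mulr1 => [|j ji]; last first.
    rewrite divff// subr_eq0 tinj//; last by rewrite eq_sym.
    by rewrite -ltnS.
  rewrite big1 ?addr0// => s si.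
  rewrite hornerZ lagrangeE (bigD1 (Ordinal iP')) 1?eq_sym//=.
  by rewrite subrr mul0r mul0r mulr0.
have sub : {subset `]t m, t m.+1[ <= `]t 0%N, t P[}.
  move=> x; apply: subset_itvW; first exact: ltn_step_le tlt _ (ltnW mP).
  exact: ltn_step_le tlt mP _.
have dE x : x \in `]t m, t m.+1[ ->
    is_derive x 1 (horner Q \- phi) (p.[x] - D 0%N x).
  move=> /sub xin; rewrite -Qp; apply: is_deriveB; exact: dphi.
have Ec : {within `[t m, t m.+1], continuous (horner Q \- phi)}.
  move=> x; apply: continuousB.
    by apply: continuous_subspaceT => ?; exact: continuous_horner.
  apply: (continuous_subspaceW _ phic) => {}x /=; apply: subset_itv.
    by rewrite bnd_simp (ltn_step_le tlt _ (ltnW mP)).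
  by rewrite bnd_simp (ltn_step_le tlt mP).
have [x xm /= ME] := MVT tm dE Ec.
rewrite [X in `|X|](_ : _ = (p.[x] - D 0%N x) * substep t m); last first.
  by rewrite /substep -ME; ring.
rewrite normrM (gtr0_norm (x := substep t m)) ?subr_gt0//.
rewrite ler_wpM2r ?subr_ge0 ?(ltW tm)// distrC.
exact: (interp_error tlt mP D0 DS Db sp pt xm).
Qed.

(** * Derivatives of the exact solution *)

Lemma mxdot_continuous (R : realType) (m n : nat) (W : 'M[R]_(m, n)) :
  continuous (mxdot W).
Proof.
apply: continuous_big => [|i _]; first exact: add_continuous.
apply: continuous_big => [|j _]; first exact: add_continuous.
move=> A; apply: (@continuousM _ _ (cst (W i j))
  (fun A : 'M[R]_(m, n) => A i j)); first exact: cst_continuous.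
exact: coord_continuous.
Qed.

Lemma mxdot_is_derive (R : realType) (m n : nat) (W dY : 'M[R]_(m, n))
    (Y : R -> 'M[R]_(m, n)) (t : R) :
  is_derive t 1 Y dY -> is_derive t 1 (fun u => mxdot W (Y u)) (mxdot W dY).
Proof.
move=> [Yd YdE].
have YE i j : is_derive t 1 (fun u => Y u i j) (dY i j).
  split; first by have /derivable_mxP := Yd.
  by rewrite -YdE derive_mx// mxE.
have -> : (fun u => mxdot W (Y u))
    = \sum_(i < m) \sum_(j < n) (W i j \*: (fun u => Y u i j)).
  apply/funext => u; rewrite fct_sumE; apply: eq_bigr => i _.
  by rewrite fct_sumE.
rewrite /mxdot; apply: is_derive_sum => i; apply: is_derive_sum => j.
Qed.

Lemma lipschitz_within_continuous (R : realType) (f : R -> R) (a b k : R) :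
  (forall x y, x \in `[a, b] -> y \in `[a, b] ->
     `|f x - f y| <= k * `|x - y|) ->
  {within `[a, b], continuous f}.
Proof.
move=> flip; apply/subspace_continuousP => x xab.
apply/cvgrPdist_le => e e0.
have k0 : 0 < `|k| + 1 by rewrite ltr_wpDl.
rewrite near_withinE; near=> y => yab.
apply: le_trans (flip _ _ xab yab) _.
apply: (@le_trans _ _ ((`|k| + 1) * `|x - y|)).
  by rewrite ler_wpM2r// (le_trans (ler_norm k))// lerDl.
rewrite -ler_pdivlMl// mulrC.
by near: y; apply: cvgr_dist_le; [exact: cvg_id|rewrite divr_gt0].
Unshelve. all: by end_near. Qed.

Definition lin (R : realType) (m1 m2 : nat) (F : rhs R m1 m2)
    (Y : 'M[R]_(m1, m2)) : 'M[R]_(m1, m2) :=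
  \sum_(j < nterms F) rhsA F j *m Y *m (rhsB F j)^T.

(** The adjoint of [lin F] for [mxdot]: moving [lin F] onto the test matrix
    makes differentiation of [lin F (Y u)] an instance of differentiation of
    [Y u]. *)
Definition linadj (R : realType) (m1 m2 : nat) (F : rhs R m1 m2)
    (W : 'M[R]_(m1, m2)) : 'M[R]_(m1, m2) :=
  \sum_(j < nterms F) (rhsA F j)^T *m W *m rhsB F j.

Lemma mxdot_lin (R : realType) (m1 m2 : nat) (F : rhs R m1 m2)
    (W Y : 'M[R]_(m1, m2)) : mxdot W (lin F Y) = mxdot (linadj F W) Y.
Proof.
rewrite mxdot_sumr [RHS]mxdotC mxdot_sumr; apply: eq_bigr => j _.
by rewrite mxdotC mxdot_mulmx trmxK.
Qed.

Lemma rhs_lin (R : realType) (m1 m2 : nat) (F : rhs R m1 m2)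
    (Y : 'M[R]_(m1, m2)) (t : R) : F Y t = lin F Y + F 0 t.
Proof.
rewrite /rhs_fun -/(lin F Y) [X in _ = _ + (X + _)]big1 ?add0r// => j _.
by rewrite mulmx0 mul0mx.
Qed.

Lemma frob_lin (R : realType) (m1 m2 : nat) (F : rhs R m1 m2) (T L : R)
    (Y : 'M[R]_(m1, m2)) :
  0 <= T -> lipschitz_rhs F T L -> frob (lin F Y) <= L * frob Y.
Proof.
move=> T0 /(_ Y 0 0 0); rewrite in_itv/= lexx T0 => /(_ isT isT).
by rewrite subrr normr0 mulr0 addr0 subr0 rhs_lin addrK.
Qed.

(** The derivative of order [k] of the solution: differentiate
    [X' = lin F X + F 0] repeatedly, the first summand being linear in [X]. *)
Fixpoint flow_deriv (R : realType) (m1 m2 : nat) (F : rhs R m1 m2)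
    (X : R -> 'M[R]_(m1, m2)) (k : nat) (t : R) : 'M[R]_(m1, m2) :=
  if k is k'.+1 then lin F (flow_deriv F X k' t) + ((F 0)^`(k'))%classic t
  else X t.

Lemma flow_deriv1 (R : realType) (m1 m2 : nat) (F : rhs R m1 m2)
    (X : R -> 'M[R]_(m1, m2)) (t : R) : flow_deriv F X 1 t = F (X t) t.
Proof. by rewrite rhs_lin. Qed.

Lemma flow_deriv_is_derive (R : realType) (m1 m2 : nat) (F : rhs R m1 m2)
    (T M : R) (d k : nat) (X0 W : 'M[R]_(m1, m2)) (X : R -> 'M[R]_(m1, m2))
    (t : R) :
  solution F T X0 X -> smooth_rhs F d T M -> (k <= d)%N -> t \in `]0, T[ ->
  is_derive t 1 (fun u => mxdot W (flow_deriv F X k u))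
    (mxdot W (flow_deriv F X k.+1 t)).
Proof.
move=> [_ _ Xd] sm kd tT; elim: k W kd => [|k IH] W kd.
  by rewrite flow_deriv1; apply: mxdot_is_derive; exact: Xd.
have -> : (fun u => mxdot W (flow_deriv F X k.+1 u))
    = (fun u => mxdot (linadj F W) (flow_deriv F X k u))
      + (fun u => mxdot W ((F 0)^`(k)%classic u)).
  by apply/funext => u; rewrite /= mxdotDr mxdot_lin.
rewrite [flow_deriv F X k.+2 t]/= mxdotDr mxdot_lin; apply: is_deriveD.
  exact: IH (ltnW kd).
apply: mxdot_is_derive; have [Gd _] := sm 0 k t kd tT.
by split=> //; rewrite -derive1E.
Qed.

(** [frob (lin F Y) <= L * frob Y], so each differentiation of [F (X u) u]
    multiplies the bound by [L] and adds the bound [M] on the derivatives of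
    [F 0]. *)
Fixpoint deriv_bound (R : realType) (L B M : R) (k : nat) : R :=
  if k is k'.+1 then L * deriv_bound L B M k' + M else B.

Lemma deriv_bound_ge0 (R : realType) (L B M : R) (k : nat) :
  0 <= L -> 0 <= B -> 0 <= M -> 0 <= deriv_bound L B M k.
Proof.
by move=> L0 B0 M0; elim: k => //= k IH; rewrite addr_ge0// mulr_ge0.
Qed.

Lemma frob_flow_deriv (R : realType) (m1 m2 : nat) (F : rhs R m1 m2)
    (T L B M : R) (d k : nat) (X : R -> 'M[R]_(m1, m2))
    (D : set 'M[R]_(m1, m2)) (t : R) :
  0 <= L -> lipschitz_rhs F T L ->
  (forall t, t \in `[0, T] -> D (X t)) -> bounded_rhs F D T B ->
  smooth_rhs F d T M -> (k <= d)%N -> t \in `]0, T[ ->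
  frob (flow_deriv F X k.+1 t) <= deriv_bound L B M k.
Proof.
move=> L0 Flip DX Fb sm kd tT; have tT' := subset_itv_oo_cc tT.
elim: k kd => [|k IH] kd.
  by rewrite flow_deriv1; apply: Fb => //; exact: DX.
rewrite [flow_deriv _ _ _ _]/= (le_trans (frobD _ _))//= lerD//.
  have T0 : 0 <= T by move: tT'; rewrite in_itv/=; lra.
  rewrite (le_trans (frob_lin _ T0 Flip))// ler_wpM2l//.
  exact: IH (ltnW kd).
by have [] := sm 0 k t kd tT.
Qed.

Lemma solution_mxdot_continuous (R : realType) (m1 m2 : nat) (F : rhs R m1 m2)
    (T a b : R) (X0 W : 'M[R]_(m1, m2)) (X : R -> 'M[R]_(m1, m2)) :
  solution F T X0 X -> 0 <= a -> b <= T ->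
  {within `[a, b], continuous (fun t => mxdot W (X t))}.
Proof.
move=> [_ Xc _] a0 bT.
apply: (@continuous_subspaceW _ _ _ `[0, T]).
  by move=> x /=; apply: subset_itv; rewrite bnd_simp.
move=> x; apply: continuous_comp; [exact: Xc|exact: mxdot_continuous].
Qed.

(** The mean value theorem holds for [X] against each fixed test matrix [W];
    the intermediate point depends on [W], which is harmless because the bounds
    on [F] used with it are uniform. *)
Lemma solution_MVT (R : realType) (m1 m2 : nat) (F : rhs R m1 m2)
    (T a b : R) (X0 W : 'M[R]_(m1, m2)) (X : R -> 'M[R]_(m1, m2)) :
  solution F T X0 X -> 0 <= a -> a < b -> b <= T ->
  exists2 x, x \in `]a, b[ &
    mxdot W (X b - X a) = mxdot W (F (X x) x) * (b - a).
Proof.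
move=> sol a0 ab bT; have [_ _ Xd] := sol.
have dX x : x \in `]a, b[ ->
    is_derive x 1 (fun t => mxdot W (X t)) (mxdot W (F (X x) x)).
  move=> xab; apply: mxdot_is_derive; apply: Xd.
  by apply: subset_itvW xab.
have [x xab E] := MVT ab dX (solution_mxdot_continuous sol a0 bT).
by exists x => //; rewrite mxdotBr.
Qed.

Lemma solution_lipschitz (R : realType) (m1 m2 : nat) (F : rhs R m1 m2)
    (T B s t : R) (X0 : 'M[R]_(m1, m2)) (X : R -> 'M[R]_(m1, m2))
    (D : set 'M[R]_(m1, m2)) :
  0 <= B -> (forall t, t \in `[0, T] -> D (X t)) -> bounded_rhs F D T B ->
  solution F T X0 X -> s \in `[0, T] -> t \in `[0, T] ->
  frob (X s - X t) <= B * `|s - t|.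
Proof.
move=> B0 DX Fb sol.
wlog lts : s t / s < t => [wl|].
  case: (ltgtP s t) => [|ts|->]; first exact: wl.
    by move=> sT tT; rewrite frob_distC distrC wl.
  by rewrite !subrr frob0 normr0 mulr0.
rewrite !in_itv/= => /andP[s0 _] /andP[_ tT].
rewrite frob_distC distrC gtr0_norm ?subr_gt0//.
apply: mxdot_le_dual => [|W]; first by rewrite mulr_ge0// subr_ge0 ltW.
have [x xst ->] := solution_MVT W sol s0 lts tT.
rewrite mulrA ler_wpM2r ?subr_ge0 ?(ltW lts)//.
rewrite (le_trans (mxdot_le_frob _ _))// ler_wpM2l ?frob_ge0//.
have xT : x \in `[0, T] by move: xst; rewrite !in_itv/=; lra.
by apply: Fb => //; exact: DX.
Qed.

(** Along the solution [F] is Lipschitz in time: the bound [B] on [F] controls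
    the motion of [X]. *)
Lemma rhs_flow_lipschitz (R : realType) (m1 m2 : nat) (F : rhs R m1 m2)
    (T L B s t : R) (X0 : 'M[R]_(m1, m2)) (X : R -> 'M[R]_(m1, m2))
    (D : set 'M[R]_(m1, m2)) :
  0 <= L -> 0 <= B -> lipschitz_rhs F T L ->
  (forall t, t \in `[0, T] -> D (X t)) -> bounded_rhs F D T B ->
  solution F T X0 X -> s \in `[0, T] -> t \in `[0, T] ->
  frob (F (X s) s - F (X t) t) <= L * (B + 1) * `|s - t|.
Proof.
move=> L0 B0 Flip DX Fb sol sT tT.
rewrite (le_trans (Flip _ _ _ _ sT tT))// -mulrDr -mulrA ler_wpM2l//.
by rewrite mulrDl mul1r lerD2r (solution_lipschitz B0 DX Fb sol).
Qed.

(** Against a test matrix, an increment of [X] is the value of [F] at an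
    intermediate time, and [rhs_flow_lipschitz] compares it with the value at
    the end, which implicit Euler uses. *)
Lemma euler_error (R : realType) (m1 m2 : nat) (F : rhs R m1 m2)
    (T L B s t : R) (X0 : 'M[R]_(m1, m2)) (X : R -> 'M[R]_(m1, m2))
    (D : set 'M[R]_(m1, m2)) :
  0 <= L -> 0 <= B -> lipschitz_rhs F T L ->
  (forall t, t \in `[0, T] -> D (X t)) -> bounded_rhs F D T B ->
  solution F T X0 X -> 0 <= s -> s < t -> t <= T ->
  frob ((t - s) *: F (X t) t - (X t - X s)) <= L * (B + 1) * (t - s) ^+ 2.
Proof.
move=> L0 B0 Flip DX Fb sol s0 lst tT.
have ts0 : 0 <= t - s by rewrite subr_ge0 ltW.
have LB0 : 0 <= L * (B + 1) by rewrite mulr_ge0// addr_ge0.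
apply: mxdot_le_dual => [|W]; first by rewrite mulr_ge0// exprn_ge0.
have [x xst E] := solution_MVT W sol s0 lst tT.
rewrite mxdotBr mxdotZr E mulrC -mulrBl -mxdotBr expr2 !mulrA ler_wpM2r//.
rewrite (le_trans (mxdot_le_frob _ _))// -!mulrA ler_wpM2l ?frob_ge0//.
have [xT tT'] : x \in `[0, T] /\ t \in `[0, T].
  by move: xst; rewrite !in_itv/=; split; lra.
rewrite (le_trans (rhs_flow_lipschitz L0 B0 Flip DX Fb sol tT' xT))//.
rewrite mulrA ler_wpM2l// ger0_norm; move: xst; rewrite in_itv/=; lra.
Qed.

(** For each test matrix [W], the scalar functions [mxdot W (flow_deriv F X k)]
    form a chain of derivatives. At the end points of the interval only
    continuity is known, and it follows from [rhs_flow_lipschitz]. *)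
Lemma solution_quadrature (R : realType) (m1 m2 P m : nat) (F : rhs R m1 m2)
    (T L B M : R) (X0 : 'M[R]_(m1, m2)) (X : R -> 'M[R]_(m1, m2))
    (D : set 'M[R]_(m1, m2)) (t : nat -> R) :
  0 <= L -> 0 <= B -> 0 <= M -> lipschitz_rhs F T L ->
  (forall t, t \in `[0, T] -> D (X t)) -> bounded_rhs F D T B ->
  smooth_rhs F P.+1 T M -> solution F T X0 X ->
  (forall i, (i < P)%N -> t i < t i.+1) -> (m < P)%N ->
  0 <= t 0%N -> t P <= T ->
  frob (\sum_(s < P.+1) (substep t m * weight t m s) *: F (X (t s)) (t s)
     - (X (t m.+1) - X (t m)))
    <= deriv_bound L B M P.+1 * (t P - t 0%N) ^+ P.+1 * substep t m.
Proof.
move=> L0 B0 M0 Flip DX Fb sm sol tlt mP t0 tP.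
have tm := tlt _ mP.
have t0P : t 0%N <= t P by exact: ltn_step_le tlt (leq0n P) _.
apply: mxdot_le_dual => [|W].
  by rewrite !mulr_ge0 ?exprn_ge0 ?subr_ge0 ?(ltW tm)// deriv_bound_ge0.
have sub x : x \in `]t 0%N, t P[ -> x \in `]0, T[ by exact: subset_itvW.
have subc x : x \in `[t 0%N, t P] -> x \in `[0, T].
  by apply: subset_itv; rewrite bnd_simp.
pose G k u := mxdot W (flow_deriv F X k.+1 u).
have Gc : {within `[t 0%N, t P], continuous (G 0%N)}.
  apply: (@lipschitz_within_continuous _ _ _ _ (frob W * (L * (B + 1)))).
  move=> x y /subc xT /subc yT; rewrite /G !flow_deriv1 -mxdotBr.
  have lip u v : u \in `[0, T] -> v \in `[0, T] ->
      mxdot W (F (X u) u - F (X v) v) <= frob W * (L * (B + 1)) * `|u - v|.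
    move=> uT vT; rewrite (le_trans (mxdot_le_frob _ _))// -mulrA.
    rewrite ler_wpM2l ?frob_ge0//.
    exact: (rhs_flow_lipschitz L0 B0 Flip DX Fb sol).
  rewrite ler_norml lip// andbT lerNl -mxdotNr opprB distrC.
  exact: lip.
have Gd k y : (k <= P)%N -> y \in `]t 0%N, t P[ ->
    is_derive y 1 (G k) (G k.+1 y).
  by move=> kP /sub yT; exact: (flow_deriv_is_derive W sol sm).
have Gb y : y \in `]t 0%N, t P[ ->
    `|G P.+1 y| <= frob W * deriv_bound L B M P.+1.
  move=> /sub yT.
  have bnd V : mxdot V (flow_deriv F X P.+2 y)
      <= frob V * deriv_bound L B M P.+1.
    rewrite (le_trans (mxdot_le_frob _ _))// ler_wpM2l ?frob_ge0//.
    exact: (frob_flow_deriv L0 Flip DX Fb sm).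
  (* The lower bound is the upper bound for - W. *)
  rewrite ler_norml bnd andbT lerNl; have := bnd (- W).
  by rewrite frobN mxdotC mxdotNr mxdotC.
have phid y : y \in `]t 0%N, t P[ ->
    is_derive y 1 (fun u => mxdot W (X u)) (G 0%N y).
  by move=> /sub yT; exact: (flow_deriv_is_derive (k := 0) W sol sm).
have := quadrature_error tlt mP (solution_mxdot_continuous sol t0 tP) phid
  Gc Gd Gb.
rewrite !mulrA; apply: le_trans; apply: le_trans (ler_norm _).
rewrite mxdotBr mxdot_sumr mxdotBr lerD2r ler_sum// => s _.
by rewrite mxdotZr /G flow_deriv1.
Qed.

(** * One substep *)

Lemma qr_proj (R : realType) (m p q : nat) (A : 'M[R]_(m, p))
    (Q : 'M[R]_(m, q)) :
  qr A Q -> Q^T *m Q = 1%:M /\ Q *m Q^T *m A = A.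
Proof.
by move=> [W [QQ -> _]]; split=> //; rewrite -mulmxA (mulmxA _ Q) QQ mul1mx.
Qed.

(** Why the scheme concatenates factors: every block that enters the
    factorization is fixed by the projection onto the resulting space. *)
Lemma qr_row3 (R : realType) (m p1 p2 p3 q : nat) (A1 : 'M[R]_(m, p1))
    (A2 : 'M[R]_(m, p2)) (A3 : 'M[R]_(m, p3)) (Q : 'M[R]_(m, q)) :
  qr (row_mx (row_mx A1 A2) A3) Q ->
  [/\ Q^T *m Q = 1%:M, Q *m Q^T *m A1 = A1, Q *m Q^T *m A2 = A2 &
      Q *m Q^T *m A3 = A3].
Proof.
move=> /qr_proj[QQ]; rewrite !mul_mx_row => /eq_row_mx[/eq_row_mx[? ?] ?].
by split.
Qed.

Lemma proj2_lrmat (R : realType) (m n p q : nat) (U : 'M[R]_(m, p))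
    (V : 'M[R]_(n, q)) (Y : lrmx R m n) :
  U *m U^T *m lrU Y = lrU Y -> V *m V^T *m lrV Y = lrV Y ->
  proj2 U V (lrmat Y) = lrmat Y.
Proof.
move=> UY VY; rewrite /lrmat -{2}UY -{2}VY /proj2.
by rewrite !trmx_mul trmxK !mulmxA.
Qed.

(** The error made on the small core matrix is that of the full matrix, since
    the outer factors are isometries. *)
Lemma tsum_frob (R : realType) (m n : nat) (eps : R) (X Y : lrmx R m n) :
  tsum eps X Y -> frob (lrmat X - lrmat Y) <= eps.
Proof.
move=> [p [q [QU [WU [QV [WV [Z [[QU1 XU _] [QV1 XV _] _ [_ Zeps] ->]]]]]]]].
apply: le_trans Zeps; rewrite -(frob_isometry _ QU1 QV1) le_eqVlt.
rewrite mulmxBr mulmxBl {1}/lrmat XU XV /lrmat /= !trmx_mul !mulmxA.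
by rewrite eqxx.
Qed.

Lemma trunc_core_frob (R : realType) (m n p q : nat) (eps : R)
    (U : 'M[R]_(m, p)) (V : 'M[R]_(n, q)) (S : 'M[R]_(p, q))
    (Z : lrmx R p q) (X : 'M[R]_(m, n)) :
  U^T *m U = 1%:M -> V^T *m V = 1%:M -> truncates eps S (lrmat Z) ->
  frob (lrmat (LR (U *m lrU Z) (lrS Z) (V *m lrV Z)) - X)
    <= frob (U *m S *m V^T - X) + eps.
Proof.
move=> UU VV [_ Seps].
rewrite (le_trans (frob_dist_trans _ (U *m S *m V^T) _))//.
rewrite addrC lerD2l frob_distC; apply: le_trans Seps.
rewrite -[leRHS](frob_isometry _ UU VV) /lrmat /= !trmx_mul.
by rewrite mulmxBr mulmxBl !mulmxA.
Qed.

(** Write the error of the projected step as the old error, plus the projected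
    increment error [F Yh - F X'], plus the part of [F X'] lost in the
    projection, plus the residual of the exact solution. Comparing with [F X']
    and not with [F Yh] in the lost part keeps the unknown error in a single
    term of size [tau * L], absorbed on the left; the lost part is unchanged by
    subtraction of [YF], which the projection fixes. *)
Lemma projected_step (R : realType) (m1 m2 p q : nat) (F : rhs R m1 m2)
    (T L gamma t' tau : R) (U : 'M[R]_(m1, p)) (V : 'M[R]_(m2, q))
    (S : 'M[R]_(p, q)) (Y YF YR X X' : 'M[R]_(m1, m2)) :
  lipschitz_rhs F T L -> t' \in `[0, T] -> 0 <= tau -> tau * L <= gamma ->
  U^T *m U = 1%:M -> V^T *m V = 1%:M ->
  proj2 U V Y = Y -> proj2 U V YF = YF -> proj2 U V YR = YR ->
  S = U^T *m Y *m V + tau *: (U^T *m F (U *m S *m V^T) t' *m V)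
      + U^T *m YR *m V ->
  (1 - gamma) * frob (U *m S *m V^T - X')
    <= frob (Y - X) + tau * frob (F X' t' - YF)
       + frob (tau *: F X' t' + YR - (X' - X)).
Proof.
move=> Flip t'T tau0 tauL UU VV PY PYF PYR SE.
set Yh := U *m S *m V^T.
have YhE : Yh = Y + tau *: proj2 U V (F Yh t') + YR.
  rewrite -{1}PY -{1}PYR /proj2 {1}/Yh {1}SE -/Yh.
  by rewrite !mulmxDr !mulmxDl -scalemxAr -scalemxAl.
have split4 : Yh - X' = (Y - X) + tau *: proj2 U V (F Yh t' - F X' t')
   - tau *: ((F X' t' - YF) - proj2 U V (F X' t' - YF))
   + (tau *: F X' t' + YR - (X' - X)).
  rewrite {1}YhE !proj2B PYF !scalerBr.
  apply/matrixP => i j; rewrite !mxE; ring.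
have FX'_ge0 := frob_ge0 (Yh - X').
have lipF : frob (F Yh t' - F X' t') <= L * frob (Yh - X').
  by have := Flip Yh X' t' t' t'T t'T; rewrite subrr normr0 mulr0 addr0.
have : frob (Yh - X') <= frob (Y - X) + tau * (L * frob (Yh - X'))
   + tau * frob (F X' t' - YF) + frob (tau *: F X' t' + YR - (X' - X)).
  rewrite {1}split4 (le_trans (frobD _ _))// lerD2r.
  rewrite (le_trans (frobD _ _))// lerD//.
    rewrite (le_trans (frobD _ _))// lerD2l frobZ ger0_norm//.
    by rewrite ler_wpM2l// (le_trans (frob_proj2 _ UU VV)).
  by rewrite frobN frobZ ger0_norm// ler_wpM2l// frob_proj2C.
have : tau * L * frob (Yh - X') <= gamma * frob (Yh - X') by rewrite ler_wpM2r.
lra.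
Qed.

(** [projected_step] without residual term. The matrix fixed by the projection
    is the truncated [F] at the old point, which differs from [F (X t') t'] by
    [L] times the old error, by O(h) for the motion in time, and by [ef]. *)
Lemma stage1_error (R : realType) (m1 m2 : nat) (F : rhs R m1 m2)
    (T L B gamma es ef t t' : R) (Y Y' : lrmx R m1 m2) (X X' : 'M[R]_(m1, m2)) :
  lipschitz_rhs F T L -> 0 <= L -> 0 <= gamma < 1 ->
  t \in `[0, T] -> t' \in `[0, T] -> t <= t' -> (t' - t) * L <= gamma ->
  frob (X' - X) <= B * (t' - t) ->
  frob ((t' - t) *: F X' t' - (X' - X)) <= L * (B + 1) * (t' - t) ^+ 2 ->
  stage1_substep F es ef t t' Y Y' ->
  (1 - gamma) * (frob (lrmat Y' - X') - es)
    <= 2 * frob (lrmat Y - X) + (t' - t) * ef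
       + 2 * L * (B + 1) * (t' - t) ^+ 2.
Proof.
move=> Flip L0 /andP[g0 g1] tT t'T tt' tauL XX' quad.
move=> [YF [Kx [Lx [p [q [U [V [S [Z [YFt _ [qrU qrV] SE [_ St ->]]]]]]]]]]].
have tau0 : 0 <= t' - t by rewrite subr_ge0.
have [UU UY UF _] := qr_row3 qrU; have [VV VY VF _] := qr_row3 qrV.
have := projected_step X X' Flip t'T tau0 tauL UU VV (proj2_lrmat UY VY)
  (proj2_lrmat UF VF) (S := S) (YR := 0).
rewrite {1}/proj2 !(mulmx0, mul0mx) !addr0 => /(_ erefl SE) step.
have FYF : frob (F X' t' - lrmat YF)
    <= L * (B * (t' - t) + frob (lrmat Y - X)) + L * (t' - t) + ef.
  rewrite (le_trans (frob_dist_trans _ (F (lrmat Y) t) _))// lerD//; last first.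
    by rewrite -lrmat_rhs_lr tsum_frob.
  rewrite (le_trans (Flip _ _ _ _ t'T tT))// ger0_norm// lerD2r ler_wpM2l//.
  by rewrite (le_trans (frob_dist_trans _ X _))// lerD// frob_distC.
have trunc := trunc_core_frob X' UU VV St.
have := ler_wpM2l tau0 FYF.
have : (t' - t) * L * frob (lrmat Y - X) <= 1 * frob (lrmat Y - X).
  by rewrite ler_wpM2r ?frob_ge0// (le_trans tauL)// ltW.
have : (1 - gamma) * (frob (lrmat (LR (U *m lrU Z) (lrS Z) (V *m lrV Z)) - X')
   - es) <= (1 - gamma) * frob (U *m S *m V^T - X').
  by rewrite ler_wpM2l ?subr_ge0 ?(ltW g1)// lerBlDr.
rewrite expr2 in quad *; lra.
Qed.

Lemma correction_error (R : realType) (m1 m2 : nat) (F : rhs R m1 m2)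
    (T L gamma es t t' : R) (YF YR Y Y' : lrmx R m1 m2)
    (X X' : 'M[R]_(m1, m2)) :
  lipschitz_rhs F T L -> gamma < 1 ->
  t' \in `[0, T] -> t <= t' -> (t' - t) * L <= gamma ->
  correction_substep F es t t' YF YR Y Y' ->
  (1 - gamma) * (frob (lrmat Y' - X') - es)
    <= frob (lrmat Y - X) + (t' - t) * frob (F X' t' - lrmat YF)
       + frob ((t' - t) *: F X' t' + lrmat YR - (X' - X)).
Proof.
move=> Flip g1 t'T tt' tauL [p [q [U [V [S [Z [qrU qrV SE [_ St ->]]]]]]]].
have tau0 : 0 <= t' - t by rewrite subr_ge0.
have [UU UY UF UR] := qr_row3 qrU; have [VV VY VF VR] := qr_row3 qrV.
apply: le_trans (projected_step X X' Flip t'T tau0 tauL UU VV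
  (proj2_lrmat UY VY) (proj2_lrmat UF VF) (proj2_lrmat UR VR) SE).
rewrite ler_wpM2l ?subr_ge0 ?(ltW g1)// lerBlDr.
exact: trunc_core_frob.
Qed.

Lemma lrmat_residual (R : realType) (m1 m2 P : nat) (t : nat -> R)
    (YF : nat -> lrmx R m1 m2) (m : nat) :
  lrmat (residual P t YF m) =
    - substep t m *: lrmat (YF m.+1)
    + \sum_(s < P.+1) (substep t m * weight t m s) *: lrmat (YF s).
Proof.
rewrite /residual lrmatD lrmatZ; congr (_ + _).
rewrite (big_morph _ (@lrmatD R m1 m2) (@lrmat0 R m1 m2)).
by apply: eq_bigr => s _; rewrite lrmatZ.
Qed.

(** * One sweep *)

(** The hypotheses common to both kinds of sweep; the bounded region and the
    initial value are quantified away because the estimates are uniform in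
    them. *)
Definition regular_flow (R : realType) (m1 m2 P : nat) (F : rhs R m1 m2)
    (T L B M : R) (X : R -> 'M[R]_(m1, m2)) : Prop :=
  exists (D : set 'M[R]_(m1, m2)) (X0 : 'M[R]_(m1, m2)),
    [/\ lipschitz_rhs F T L, forall t, t \in `[0, T] -> D (X t),
        bounded_rhs F D T B, smooth_rhs F P.+1 T M & solution F T X0 X].

(** A discrete Gronwall inequality: with [1 <= a], each of the [m] increments
    [b] is amplified at most [a ^+ m] times. *)
Lemma affine_recursion_le (R : realType) (P : nat) (a b : R) (d : nat -> R) :
  1 <= a -> 0 <= b -> d 0%N <= 0 ->
  (forall m, (m < P)%N -> d m.+1 <= a * d m + b) ->
  forall m, (m <= P)%N -> d m <= P%:R * a ^+ P * b.
Proof.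
move=> a1 b0 d0 dS m mP; have a0 : 0 <= a by rewrite (le_trans ler01).
apply: (@le_trans _ _ (m%:R * a ^+ m * b)); last first.
  rewrite ler_wpM2r// ler_pM ?exprn_ge0 ?ler_nat//.
  by rewrite ler_weXn2l.
elim: m mP => [|m IH] mP; first by rewrite !mul0r.
apply: le_trans (dS m mP) _; rewrite exprS -natr1.
have := ler_wpM2l a0 (IH (ltnW mP)).
have : 1 * b <= a ^+ m.+1 * b by rewrite ler_wpM2r// exprn_ege1.
rewrite exprS; lra.
Qed.

(** Each substep amplifies the error by at most [2 / (1 - gamma)] and adds an
    implicit Euler error. *)
Lemma stage1_sweep (R : realType) (m1 m2 P : nat) (F : rhs R m1 m2)
    (T L B M gamma es ef : R) (X : R -> 'M[R]_(m1, m2)) (t : nat -> R)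
    (Y : nat -> lrmx R m1 m2) :
  regular_flow P F T L B M X -> 0 <= L -> 0 <= B -> 0 <= gamma < 1 ->
  0 <= es -> 0 <= ef ->
  (forall i, (i < P)%N -> t i < t i.+1) -> 0 <= t 0%N -> t P <= T ->
  (t P - t 0%N) * L <= gamma ->
  (forall m, (m < P)%N ->
     stage1_substep F es ef (t m) (t m.+1) (Y m) (Y m.+1)) ->
  lrmat (Y 0%N) = X (t 0%N) ->
  forall m, (m <= P)%N ->
  frob (lrmat (Y m) - X (t m)) <=
    P%:R * (2 / (1 - gamma)) ^+ P *
    ((1 - gamma)^-1 * ((t P - t 0%N) * ef
       + 2 * L * (B + 1) * (t P - t 0%N) ^+ 2) + es).
Proof.
move=> [D [X0 [Flip DX Fb sm sol]]] L0 B0 g01 es0 ef0 tlt t0 tP tL sub Y0.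
have /andP[g0 g1] := g01; have h0 : 0 <= t P - t 0%N.
  by rewrite subr_ge0 (ltn_step_le tlt (leq0n P)).
have g1' : 0 < 1 - gamma by rewrite subr_gt0.
have LB0 : 0 <= 2 * L * (B + 1) by rewrite !mulr_ge0 ?addr_ge0.
apply: (affine_recursion_le (d := fun m => frob (lrmat (Y m) - X (t m)))).
- by rewrite ler_pdivlMr// mul1r; lra.
- rewrite addr_ge0// mulr_ge0 ?invr_ge0 ?(ltW g1')//.
  by rewrite addr_ge0 ?(mulr_ge0 LB0) ?exprn_ge0// mulr_ge0.
- by rewrite Y0 subrr frob0.
move=> m mP; have tm := tlt _ mP.
have tin i : (i <= P)%N -> t i \in `[0, T].
  move=> iP; rewrite in_itv/= (le_trans t0 (ltn_step_le tlt _ iP))//=.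
  exact: le_trans (ltn_step_le tlt iP _) tP.
have tau_h : t m.+1 - t m <= t P - t 0%N.
  by rewrite lerB// (ltn_step_le tlt)// ltnW.
have tau0 : 0 <= t m.+1 - t m by rewrite subr_ge0 ltW.
have tm1 := tin _ mP; have tm0 := tin _ (ltnW mP).
have step := stage1_error Flip L0 g01 tm0 tm1 (ltW tm)
  (le_trans (ler_wpM2r L0 tau_h) tL) _ _ (sub m mP).
have {}step := step B (X (t m)) (X (t m.+1)).
have {}step : (1 - gamma) * (frob (lrmat (Y m.+1) - X (t m.+1)) - es) <=
    2 * frob (lrmat (Y m) - X (t m)) + (t m.+1 - t m) * ef
       + 2 * L * (B + 1) * (t m.+1 - t m) ^+ 2.
  apply: step.
    have := solution_lipschitz B0 DX Fb sol tm1 tm0.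
    by rewrite (ger0_norm tau0).
  apply: (euler_error L0 B0 Flip DX Fb sol _ tm).
    by move: tm0; rewrite in_itv/= => /andP[].
  by move: tm1; rewrite in_itv/= => /andP[].
rewrite addrA -lerBlDr -(ler_pM2l g1'); apply: le_trans step _.
have -> : forall x y : R,
    (1 - gamma) * (2 / (1 - gamma) * x + (1 - gamma)^-1 * y) = 2 * x + y.
  by move=> x y; field; rewrite gt_eqF.
have := ler_wpM2r ef0 tau_h.
have : 2 * L * (B + 1) * (t m.+1 - t m) ^+ 2
    <= 2 * L * (B + 1) * (t P - t 0%N) ^+ 2.
  by rewrite ler_wpM2l// lerXn2r// nnegrE.
lra.
Qed.

(** The residual of the exact solution in a corrected substep splits into the
    truncation of the residual matrix, the errors of the truncated [F] of the
    previous iterate (weighted by the step and by the quadrature weights), and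
    the quadrature error of the exact solution. The error [E] of the previous
    iterate therefore occurs only multiplied by the step. *)
Lemma correction_sweep (R : realType) (m1 m2 P : nat) (F : rhs R m1 m2)
    (T L B M gamma Lam es ef er E : R) (X : R -> 'M[R]_(m1, m2))
    (t : nat -> R) (Y YF YR Z : nat -> lrmx R m1 m2) :
  regular_flow P F T L B M X -> 0 <= L -> 0 <= B -> 0 <= M ->
  0 <= gamma < 1 -> 0 <= es -> 0 <= er ->
  (forall i, (i < P)%N -> t i < t i.+1) -> 0 <= t 0%N -> t P <= T ->
  (t P - t 0%N) * L <= gamma ->
  (forall m, (m < P)%N -> \sum_(s < P.+1) `|weight t m s| <= Lam) ->
  (forall m, (m <= P)%N -> frob (lrmat (Y m) - X (t m)) <= E) ->
  (forall m, (m <= P)%N -> tsum ef (rhs_lr F (Y m) (t m)) (YF m)) ->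
  (forall m, (m < P)%N -> tsum er (residual P t YF m) (YR m) /\
     correction_substep F es (t m) (t m.+1) (YF m.+1) (YR m)
       (Z m) (Z m.+1)) ->
  lrmat (Z 0%N) = X (t 0%N) ->
  forall m, (m <= P)%N ->
  frob (lrmat (Z m) - X (t m)) <=
    P%:R * (1 - gamma)^-1 ^+ P *
    ((1 - gamma)^-1 * ((2 + Lam) * (t P - t 0%N) * (L * E + ef) + er
       + deriv_bound L B M P.+1 * (t P - t 0%N) ^+ P.+2) + es).
Proof.
move=> [D [X0 [Flip DX Fb sm sol]]] L0 B0 M0 g01 es0 er0 tlt t0 tP tL wLam
  YE YFt sub Z0.
have /andP[g0 g1] := g01; have h0 : 0 <= t P - t 0%N.
  by rewrite subr_ge0 (ltn_step_le tlt (leq0n P)).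
have g1' : 0 < 1 - gamma by rewrite subr_gt0.
have tin i : (i <= P)%N -> t i \in `[0, T].
  move=> iP; rewrite in_itv/= (le_trans t0 (ltn_step_le tlt _ iP))//=.
  exact: le_trans (ltn_step_le tlt iP _) tP.
set eta := L * E + ef.
have FYF i : (i <= P)%N -> frob (F (X (t i)) (t i) - lrmat (YF i)) <= eta.
  move=> iP; rewrite (le_trans (frob_dist_trans _ (F (lrmat (Y i)) (t i)) _))//.
  rewrite lerD//; last by rewrite -lrmat_rhs_lr; apply: tsum_frob; exact: YFt.
  have := Flip (X (t i)) (lrmat (Y i)) _ _ (tin i iP) (tin i iP).
  rewrite subrr normr0 mulr0 addr0 frob_distC (frob_distC (X _)) => /le_trans.
  by apply; rewrite ler_wpM2l// YE.
have eta0 : 0 <= eta by apply: le_trans (FYF 0%N isT); exact: frob_ge0.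
have b0 := deriv_bound_ge0 P.+1 L0 B0 M0.
set b := deriv_bound _ _ _ _ in b0 *.
(* The sign of Lam is read off from a weight, so there must be a substep. *)
case: (posnP P) => [P0|P_gt0].
  move=> m; rewrite P0 leqn0 => /eqP ->.
  by rewrite Z0 subrr frob0 !mul0r.
have Lam0 : 0 <= Lam.
  by apply: le_trans (wLam 0%N P_gt0); rewrite sumr_ge0.
apply: (affine_recursion_le (d := fun m => frob (lrmat (Z m) - X (t m)))).
- by rewrite invf_ge1//; lra.
- rewrite addr_ge0// mulr_ge0 ?invr_ge0 ?(ltW g1')//.
  apply: addr_ge0; last by rewrite (mulr_ge0 b0)// exprn_ge0.
  by apply: addr_ge0 => //; rewrite !mulr_ge0// addr_ge0.
- by rewrite Z0 subrr frob0.
move=> m mP; have tm := tlt _ mP; have [YRt stepZ] := sub m mP.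
have tau_h : t m.+1 - t m <= t P - t 0%N.
  by rewrite lerB// (ltn_step_le tlt)// ltnW.
have tau0 : 0 <= t m.+1 - t m by rewrite subr_ge0 ltW.
have step := correction_error (X (t m)) (X (t m.+1)) Flip g1 (tin _ mP) (ltW tm)
  (le_trans (ler_wpM2r L0 tau_h) tL) stepZ.
pose quad := \sum_(s < P.+1) (substep t m * weight t m s)
  *: F (X (t s)) (t s) - (X (t m.+1) - X (t m)).
have quadE : frob quad <= b * (t P - t 0%N) ^+ P.+2.
  have := solution_quadrature L0 B0 M0 Flip DX Fb sm sol tlt mP t0 tP.
  move/le_trans; apply; rewrite [_ ^+ P.+2]exprSr mulrA ler_wpM2l//.
  by rewrite mulr_ge0// exprn_ge0.
have res : frob ((t m.+1 - t m) *: F (X (t m.+1)) (t m.+1) + lrmat (YR m)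
    - (X (t m.+1) - X (t m))) <= er + (1 + Lam) * (t P - t 0%N) * eta
      + b * (t P - t 0%N) ^+ P.+2.
  have -> : (t m.+1 - t m) *: F (X (t m.+1)) (t m.+1) + lrmat (YR m)
      - (X (t m.+1) - X (t m))
    = - (lrmat (residual P t YF m) - lrmat (YR m))
      + (substep t m *: (F (X (t m.+1)) (t m.+1) - lrmat (YF m.+1))
      - \sum_(s < P.+1) (substep t m * weight t m s)
          *: (F (X (t s)) (t s) - lrmat (YF s))) + quad.
    rewrite (eq_bigr _ (fun s _ => scalerBr _ _ _)) sumrB.
    rewrite lrmat_residual /quad scalerBr scaleNr /substep.
    by apply/matrixP => i j; rewrite !mxE; ring.
  rewrite (le_trans (frobD _ _))// lerD// (le_trans (frobD _ _))// lerD//.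
    by rewrite frobN tsum_frob.
  rewrite (le_trans (frobD _ _))// mulrDl mulrDl lerD//.
    rewrite frobZ mul1r ger0_norm//.
    by apply: ler_pM => //; [exact: frob_ge0|exact: FYF].
  rewrite frobN (le_trans (frob_sum _))//.
  apply: (@le_trans _ _ (\sum_(s < P.+1) `|weight t m s|
                         * ((t P - t 0%N) * eta))).
    apply: ler_sum => s _; rewrite frobZ normrM (ger0_norm tau0).
    rewrite (mulrC (substep _ _)) -mulrA ler_wpM2l//.
    apply: ler_pM => //; first exact: frob_ge0.
    by apply: FYF; rewrite -ltnS.
  rewrite -mulr_suml -mulrA ler_wpM2r ?wLam//.
  by rewrite mulr_ge0.
rewrite addrA -lerBlDr -(ler_pM2l g1'); apply: le_trans step _.
have -> : forall x y : R,
    (1 - gamma) * ((1 - gamma)^-1 * x + (1 - gamma)^-1 * y) = x + y.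
  by move=> x y; field; rewrite gt_eqF.
have : (t m.+1 - t m) * frob (F (X (t m.+1)) (t m.+1) - lrmat (YF m.+1))
    <= (t P - t 0%N) * eta.
  by apply: ler_pM => //; [exact: frob_ge0|exact: FYF].
move: res; lra.
Qed.

(** * Accumulation of the orders and of the tolerances *)

(** For nodes [c] in the unit interval, each product bounds a Lagrange
    polynomial there; in terms of the relative positions the bound on the
    weights does not involve the step. *)
Definition lebesgue_cst (R : realType) (P : nat) (c : nat -> R) : R :=
  \sum_(s < P.+1) \prod_(j < P.+1 | j != s) `|c s - c j|^-1.

Lemma sum_weight_le (R : realType) (P m : nat) (c : nat -> R) (tn h : R) :
  rel_nodes P c -> 0 < h -> (m < P)%N ->
  \sum_(s < P.+1) `|weight (node tn h c) m s| <= lebesgue_cst P c.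
Proof.
move=> [c0 cP clt] h0 mP; apply: ler_sum => s _.
have tlt i : (i < P)%N -> node tn h c i < node tn h c i.+1.
  by move=> iP; rewrite /node ltrD2l ltr_pM2l// clt.
rewrite (le_trans (weight_bound s tlt mP))// le_eqVlt; apply/orP; left.
apply/eqP/eq_bigr => j _; rewrite /node c0 cP.
have -> : tn + h * c s - (tn + h * c j) = h * (c s - c j) by ring.
rewrite normrM (gtr0_norm h0) invfM mulr0 mulr1 addr0 addrAC subrr add0r.
by rewrite mulrA divff ?mul1r// gt_eqF.
Qed.

(** Accumulated tolerance after [k] corrections: what was there shrinks by the
    factor [h], and the tolerances [rho] of the current sweep are added. *)
Fixpoint tol_acc (R : realType) (h d : R) (rho : nat -> R) (k : nat) : R :=
  if k is k'.+1 then h * tol_acc h d rho k' + rho k else d.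

Lemma tol_acc_ge0 (R : realType) (h d : R) (rho : nat -> R) (K k : nat) :
  0 <= h -> 0 <= d -> (forall i, (1 <= i <= K)%N -> 0 <= rho i) ->
  (k <= K)%N -> 0 <= tol_acc h d rho k.
Proof.
move=> h0 d0 rho0; elim: k => //= k IH kK.
by rewrite addr_ge0 ?rho0// mulr_ge0// IH// ltnW.
Qed.

Lemma tol_accE (R : realType) (h d : R) (rho : nat -> R) (k : nat) :
  tol_acc h d rho k
  = h ^+ k * d + \sum_(1 <= i < k.+1) h ^+ (k - i) * rho i.
Proof.
elim: k => [|k IH]; first by rewrite big_nil expr0 mul1r addr0.
rewrite [tol_acc _ _ _ _]/= IH [in RHS]big_nat_recr// subnn expr0 mul1r.
rewrite exprS mulrDr mulrA addrA.
congr (_ + _ + _); rewrite big_distrr/= !big_nat; apply: eq_bigr => i.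
by rewrite ltnS => /andP[_ ik]; rewrite subSn// exprS mulrA.
Qed.

Lemma expr_le_low_order (R : realType) (h G : R) (n m N : nat) :
  0 <= h -> h <= G -> 1 <= G -> (n <= m <= N)%N -> h ^+ m <= G ^+ N * h ^+ n.
Proof.
move=> h0 hG G1 /andP[nm mN]; have G0 : 0 <= G by exact: le_trans h0 hG.
rewrite -(subnK nm) exprD ler_wpM2r ?exprn_ge0//.
apply: (@le_trans _ _ (G ^+ (m - n))); first by rewrite lerXn2r ?nnegrE.
by rewrite ler_weXn2l// (leq_trans (leq_subr _ _)).
Qed.

(** The error constant after [k] corrections; [k1] and [k2] are the constants
    of the first stage and of a correction sweep, and [G] compares powers of
    [h]. *)
Fixpoint err_cst (R : realType) (k1 k2 G : R) (k : nat) : R :=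
  if k is k'.+1 then k2 * ((err_cst k1 k2 G k' + 1) * (G + 1)) else k1.

Lemma err_cst_ge0 (R : realType) (k1 k2 G : R) (k : nat) :
  0 <= k1 -> 0 <= k2 -> 0 <= G -> 0 <= err_cst k1 k2 G k.
Proof.
by move=> k10 k20 G0; elim: k => //= k IH; rewrite !mulr_ge0// addr_ge0.
Qed.

(** Multiplication by [h] raises the order by one until the quadrature order
    [P.+2] is reached; surplus powers of the bounded [h] go into the constant.
    *)
Lemma order_gain (R : realType) (h G C d r : R) (k P : nat) :
  0 <= h -> h <= G -> 1 <= G -> 0 <= C -> 0 <= d -> 0 <= r ->
  h * (C * (d + h ^+ minn k.+2 P.+2)) + r + h ^+ P.+2
  <= (C + 1) * (G ^+ P.+3 + 1) * (h * d + r + h ^+ minn k.+3 P.+2).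
Proof.
move=> h0 hG G1 C0 d0 r0; set x := h ^+ minn k.+3 P.+2.
have G0 : 0 <= G ^+ P.+3 by rewrite exprn_ge0// (le_trans h0).
have x0 : 0 <= x by rewrite exprn_ge0.
have hd0 : 0 <= h * d by rewrite mulr_ge0.
have le1 : h * h ^+ minn k.+2 P.+2 <= G ^+ P.+3 * x.
  rewrite -exprS; apply: expr_le_low_order => //; apply/andP; split.
    by rewrite -minnSS leq_min !geq_min !leqnn/= leqnSn orbT.
  by rewrite ltnS geq_minr.
have le2 : h ^+ P.+2 <= G ^+ P.+3 * x.
  by apply: expr_le_low_order; rewrite // geq_minr leqnSn.
have := ler_wpM2l C0 le1.
have := mulr_ge0 (mulr_ge0 C0 G0) (addr_ge0 hd0 r0).
have := mulr_ge0 G0 (addr_ge0 hd0 r0).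
have := mulr_ge0 C0 r0; have := mulr_ge0 C0 x0.
lra.
Qed.

(* C and Cd play the roles of C_{K+1} and of the constants in the O-terms: they
   depend on L, B, P, K, gamma, on the relative positions c of the nodes and on
   the smoothness bound M, but not on the problem, its dimensions, h, or the
   tolerances. *)
Theorem theorem3p2 (R : realType) (P K : nat) (c : nat -> R)
    (L B M gamma : R) :
  (0 < P)%N -> rel_nodes P c ->
  0 < L -> 0 < B -> 0 < M -> 0 < gamma -> gamma < 1 ->
  exists C Cd : R, 0 < C /\ 0 < Cd /\
  forall (h es ef : R) (esk efk erk : nat -> R),
    0 < h -> h * L <= gamma ->
    0 <= es -> 0 <= ef ->
    (forall k, (1 <= k <= K)%N -> [/\ 0 <= esk k.+1, 0 <= efk k & 0 <= erk k]) ->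
  exists delta : nat -> R,
    [/\ (forall k, (1 <= k <= K.+1)%N -> 0 <= delta k),
        delta 1%N <= Cd * (es + ef * h),
        (forall k, (1 <= k <= K)%N ->
           delta k.+1 <= Cd * (h * delta k + (esk k.+1 + h * efk k + erk k))),
        (forall k, (1 <= k <= K)%N ->
           delta k.+1 <= Cd * (h ^+ k * es + h ^+ k.+1 * ef
             + \sum_(1 <= i < k.+1)
                 h ^+ (k - i) * (esk i.+1 + h * efk i + erk i))) &
        forall (m1 m2 : nat) (F : rhs R m1 m2) (T tn : R)
               (X0 : 'M[R]_(m1, m2)) (X : R -> 'M[R]_(m1, m2))
               (D : set 'M[R]_(m1, m2)) (Xn Xout : lrmx R m1 m2),
          lipschitz_rhs F T L ->
          (forall t, t \in `[0, T] -> D (X t)) -> bounded_rhs F D T B ->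
          smooth_rhs F P.+1 T M ->
          solution F T X0 X ->
          0 <= tn -> tn + h <= T ->
          svd Xn -> lrmat Xn = X tn ->
          sdc_mbug F P K (node tn h c) es ef esk efk erk Xn Xout ->
          frob (lrmat Xout - X (tn + h))
            <= C * (delta K.+1 + h ^+ minn K.+2 P.+2)].
Proof.
move=> P0 nodes L_gt0 B_gt0 M_gt0 g_gt0 g1.
have [[[L0 B0] M0] g0] := (ltW L_gt0, ltW B_gt0, ltW M_gt0, ltW g_gt0).
(* k1 and k2 are the constants of stage1_sweep and correction_sweep, enlarged
   so that every tolerance and power of h enters with coefficient one; G
   bounds h. *)
pose a := (1 - gamma)^-1; pose Lam := lebesgue_cst P c.
pose b := deriv_bound L B M P.+1; pose G := 1 + L^-1.
pose k1 := P%:R * (2 / (1 - gamma)) ^+ P * (a * (1 + 2 * L * (B + 1)) + 1).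
pose k2 := P%:R * a ^+ P * (a * ((2 + Lam) * (L + 1) + b + 1) + 1).
have a0 : 0 <= a by rewrite invr_ge0 subr_ge0 ltW.
have Lam0 : 0 <= Lam.
  by apply: sumr_ge0 => s _; apply: prodr_ge0 => j _; rewrite invr_ge0.
have b0 : 0 <= b by exact: deriv_bound_ge0.
have LB0 : 0 <= 2 * L * (B + 1) by rewrite !mulr_ge0 ?addr_ge0.
have LamL0 : 0 <= (2 + Lam) * (L + 1) by rewrite mulr_ge0 ?addr_ge0.
have k10 : 0 <= k1.
  rewrite !mulr_ge0 ?addr_ge0 ?mulr_ge0 ?addr_ge0 ?exprn_ge0//.
  by rewrite mulr_ge0.
have k20 : 0 <= k2.
  rewrite mulr_ge0 ?(mulr_ge0 _ (exprn_ge0 _ a0))//.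
  by rewrite addr_ge0// (mulr_ge0 a0)// addr_ge0// (addr_ge0 LamL0).
have G1 : 1 <= G by rewrite lerDl invr_ge0.
have GP0 : 0 <= G ^+ P.+3 by rewrite exprn_ge0// (le_trans ler01).
have errC0 k : 0 <= err_cst k1 k2 (G ^+ P.+3) k by exact: err_cst_ge0.
exists (err_cst k1 k2 (G ^+ P.+3) K + 1), 1; split; first by rewrite ltr_wpDl.
split=> // h es ef esk efk erk h_gt0 hL es0 ef0 tol0.
have h0 := ltW h_gt0.
pose rho k := esk k.+1 + h * efk k + erk k.
have rho0 k : (1 <= k <= K)%N -> 0 <= rho k.
  by move=> /tol0[? ? ?]; rewrite /rho !addr_ge0// mulr_ge0.
have d0 : 0 <= es + ef * h by rewrite addr_ge0// mulr_ge0.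
pose tol := tol_acc h (es + ef * h) rho.
have tol_ge0 k : (k <= K)%N -> 0 <= tol k by exact: tol_acc_ge0.
(* The superscript 1 of the first stage is index 0 of tol_acc. *)
exists (fun k => tol k.-1); split.
- by move=> [//|k] /=; rewrite ltnS; exact: tol_ge0.
- by rewrite mul1r.
- by move=> [//|k] _; rewrite mul1r.
- move=> k _; rewrite mul1r /= /tol tol_accE lerD2r mulrDr exprSr.
  by rewrite -mulrA (mulrC ef).
move=> m1 m2 F T tn X0 X D Xn Xout Flip DX Fb sm sol tn0 tnT _ XnE.
move=> [Y [YF [YR [Y0 Y1 YFt Ycorr ->]]]].
have flow : regular_flow P F T L B M X by exists D, X0.
set t := node tn h c in Y1 YFt Ycorr.
have [c0 cP clt] := nodes.
have t0 : t 0%N = tn by rewrite /t /node c0 mulr0 addr0.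
have tP : t P = tn + h by rewrite /t /node cP mulr1.
have th : t P - t 0%N = h by rewrite tP t0 addrAC subrr add0r.
have tlt i : (i < P)%N -> t i < t i.+1.
  by move=> iP; rewrite /t /node ltrD2l ltr_pM2l// clt.
have hG : h <= G.
  have : h <= gamma / L by rewrite ler_pdivlMr.
  have : gamma / L <= L^-1 by rewrite ler_piMl ?invr_ge0// ltW.
  by rewrite /G; lra.
have g01 : 0 <= gamma < 1 by rewrite g0.
have start k : (k <= K)%N -> lrmat (Y k.+1 0%N) = X (t 0%N).
  by move=> kK; rewrite Y0// XnE t0.
suff err k : (k <= K)%N -> forall m, (m <= P)%N ->
    frob (lrmat (Y k.+1 m) - X (t m))
      <= err_cst k1 k2 (G ^+ P.+3) k * (tol k + h ^+ minn k.+2 P.+2).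
  rewrite -tP (le_trans (err K (leqnn _) P (leqnn _)))//.
  by rewrite ler_wpM2r ?lerDl// addr_ge0 ?exprn_ge0// tol_ge0.
elim: k => [_|k IH kK] m mP.
  have := stage1_sweep (Y := Y 1%N) flow L0 B0 g01 es0 ef0 tlt.
  rewrite th t0 tP => sweep.
  apply: le_trans (sweep tn0 tnT hL Y1 _ m mP) _; first by rewrite start// t0.
  rewrite [err_cst _ _ _ _]/= /k1 -(mulrA (P%:R * _ ^+ P)).
  rewrite ler_wpM2l ?mulr_ge0 ?exprn_ge0 ?mulr_ge0//.
  rewrite /tol/= -/a !minnSS min0n.
  have := mulr_ge0 a0 es0; have := mulr_ge0 a0 (mulr_ge0 h0 ef0).
  have := mulr_ge0 (mulr_ge0 a0 LB0) es0.
  have := mulr_ge0 (mulr_ge0 a0 LB0) (mulr_ge0 h0 ef0).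
  have := sqr_ge0 h; have := mulr_ge0 a0 (sqr_ge0 h); have := mulr_ge0 h0 ef0.
  lra.
have kK' : (1 <= k.+1 <= K)%N by [].
have [esk0 efk0 erk0] := tol0 _ kK'.
set E := err_cst k1 k2 (G ^+ P.+3) k * (tol k + h ^+ minn k.+2 P.+2) in IH.
have E0 : 0 <= E by rewrite mulr_ge0// addr_ge0 ?exprn_ge0 ?tol_ge0// ltnW.
have := correction_sweep (Lam := Lam) (E := E) (es := esk k.+2)
  (ef := efk k.+1) (er := erk k.+1) (Y := Y k.+1) (YF := YF k.+1)
  (YR := YR k.+1) (Z := Y k.+2) flow L0 B0 M0 g01 esk0 erk0 tlt.
rewrite th t0 tP => sweep.
apply: le_trans (sweep tn0 tnT hL _ (IH (ltnW kK)) _ _ _ m mP) _.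
- by move=> i iP; exact: sum_weight_le.
- by move=> i iP; exact: YFt.
- by move=> i iP; exact: Ycorr.
- by rewrite start// t0.
have := @order_gain _ h G (err_cst k1 k2 (G ^+ P.+3) k) (tol k) (rho k.+1) k P
  h0 hG G1 (errC0 k) (tol_ge0 k (ltnW kK)) (rho0 _ kK').
rewrite -/E => gain.
rewrite [err_cst _ _ _ _]/= -(mulrA k2).
apply: le_trans (ler_wpM2l k20 gain).
rewrite /k2 -(mulrA (P%:R * a ^+ P)) ler_wpM2l ?mulr_ge0 ?exprn_ge0//.
rewrite /rho -/a -/b.
set x := h ^+ P.+2; have x0 : 0 <= x by rewrite exprn_ge0.
set y := h * E; have y0 : 0 <= y by rewrite mulr_ge0.
set z := h * efk k.+1; have z0 : 0 <= z by rewrite mulr_ge0.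
rewrite [X in _ * (X + _ + _) + _](_ : _ = (2 + Lam) * (L * y + z)); last first.
  by rewrite /y /z; ring.
(* Expanded, the right-hand side has the terms of the left-hand side and
   further products of nonnegative quantities; with the signs of these products
   supplied, the comparison is linear. *)
have a2 : 0 <= a * (2 + Lam) by rewrite mulr_ge0// addr_ge0.
have a2L := mulr_ge0 a2 L0; have ab := mulr_ge0 a0 b0.
move: (esk k.+2) (erk k.+1) esk0 erk0 => u v u0 v0.
have := (mulr_ge0 a2 y0, mulr_ge0 a2 u0, mulr_ge0 a2 v0, mulr_ge0 a2 x0).
move=> [[[? ?] ?] ?].
have := (mulr_ge0 a2L z0, mulr_ge0 a2L u0, mulr_ge0 a2L v0, mulr_ge0 a2L x0).
move=> [[[? ?] ?] ?].
have := (mulr_ge0 ab z0, mulr_ge0 ab u0, mulr_ge0 ab v0, mulr_ge0 ab y0).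
move=> [[[? ?] ?] ?].
have := (mulr_ge0 a0 z0, mulr_ge0 a0 u0, mulr_ge0 a0 x0, mulr_ge0 a0 y0).
move=> [[[? ?] ?] ?].
lra.
Qed.
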